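(* For every fixed $\eta>0$ there are constants $c_\eta,C_\eta>0$ (depending only on $\eta$) with the following property. Let $d,n$ be integers with $2\le d\le n$. There is a randomized online algorithm producing signs $\varepsilon_1,\varepsilon_2,\ldots\in\{-1,1\}$ such that for any positive integer $T$ and any fixed sequence of vectors $a_1,\ldots,a_T\in[-1,1]^n$ in which every vector $a_t$ has at most $d$ nonzero entries, $$\mathbb{P}\left\{\max_{t\le T}\Big\|\sum_{s\le t}\varepsilon_s a_s\Big\|_\infty> C_\eta\sqrt d\right\}\le C_\eta\,T\exp\left(-\frac{c_\eta\,d}{\log^{2+\eta}(e\,d)}\right).$$ Consequently, there are constants $C,C',T_0>0$ depending only on $\eta$ such that the prefix discrepancy of any such sequence $a_1,\ldots,a_T$ is at most $C'\sqrt d$ whenever $T\ge T_0$ and $$d\ge C(\log T)(\log\log T)^{2+\eta}.$$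
   Context: $\log$ is the natural logarithm and $\log^{p}(x)$ means $(\log x)^p$. Randomized online algorithm (oblivious adversary): the vectors $a_1,\ldots,a_T$ are fixed (non-random) ahead of time but hidden from the algorithm, and are revealed one at a time; at time $t$, after seeing $a_1,\ldots,a_t$, the algorithm immediately and irrevocably chooses a sign $\varepsilon_t\in\{-1,1\}$ as a function only of $a_1,\ldots,a_t$ and its own internal randomness (which does not depend on the vectors). The probability is over the internal randomness of the algorithm. The prefix discrepancy of a sequence $a_1,\ldots,a_T$ is $\min_{\varepsilon\in\{-1,1\}^T}\max_{t\le T}\big\|\sum_{s\le t}\varepsilon_s a_s\big\|_\infty$. *)

(* Defs.v *)
From HB Require Import structures.
From mathcomp Require Import all_boot all_order all_algebra.
From mathcomp Require Import all_classical all_reals all_analysis.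

Set Implicit Arguments.
Unset Strict Implicit.
Unset Printing Implicit Defensive.

Import Order.TTheory GRing.Theory Num.Theory.
Import numFieldNormedType.Exports.

Local Open Scope classical_set_scope.
Local Open Scope ring_scope.

(* Signs are encoded as booleans b, read as (-1) ^+ b. *)

(* The internal randomness is a point w of a probability space that is fixed
   before any vector is revealed.  [alg_sign h w] is the sign given to the last
   vector of the revealed history h = [:: a_1; ...; a_t].  Earlier signs need
   not be an argument, being themselves determined by w and prefixes of h. *)
Record online_algorithm (R : realType) (n : nat) := OnlineAlgorithm {
  alg_display : measure_display ;
  alg_space : measurableType alg_display ;
  alg_prob : probability alg_space R ;
  alg_sign : seq 'rV[R]_n -> alg_space -> bool ;
  alg_measurable : forall h : seq 'rV[R]_n,
    measurable_fun [set: alg_space] (alg_sign h)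
}.

(* Index t : 'I_T stands for time t + 1, at which t.+1 vectors are known. *)
Definition online_signs (R : realType) (n T : nat) (A : online_algorithm R n)
    (a : T.-tuple 'rV[R]_n) (w : alg_space A) : {ffun 'I_T -> bool} :=
  [ffun t : 'I_T => alg_sign (take t.+1 a) w].

(* The norm of 'rV[R]_n is the sup norm (mx_norm); norms being nonnegative,
   the default value 0 does not affect the maximum. *)
Definition max_prefix_norm (R : realType) (n T : nat)
    (a : T.-tuple 'rV[R]_n) (e : {ffun 'I_T -> bool}) : R :=
  \big[Num.max/0]_(t < T) `| \sum_(s < T | (s <= t)%N) (-1) ^+ e s *: tnth a s |.

Definition prefix_discrepancy (R : realType) (n T : nat)
    (a : T.-tuple 'rV[R]_n) : R :=
  max_prefix_norm a
    [arg min_(e < [ffun => false] : {ffun 'I_T -> bool}) max_prefix_norm a e]%O.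

Definition sparse_unit_vectors (R : realType) (n d T : nat)
    (a : T.-tuple 'rV[R]_n) : Prop :=
  forall t : 'I_T,
    (forall i : 'I_n, -1 <= tnth a t 0 i <= 1) /\
    (#|[set i : 'I_n | (tnth a t 0 i != 0)%R]%SET| <= d)%N.

(* Main.v *)
Require Import Defs.
From HB Require Import structures.
From mathcomp Require Import all_boot all_order all_algebra.
From mathcomp Require Import all_classical all_reals all_analysis.
From mathcomp Require Import measurable_realfun.
From mathcomp Require Import ring lra zify.

Set Implicit Arguments.
Unset Strict Implicit.
Unset Printing Implicit Defensive.

Import Order.TTheory GRing.Theory Num.Theory.
Import numFieldNormedType.Exports.

Local Open Scope classical_set_scope.
Local Open Scope ring_scope.

(** Write X_t for the signed sum of the first t vectors.  The algorithm keeps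
    the law of X_t below one fixed probability measure mu, carried by a box of
    side O(sqrt d), in the following sense: E u(X_t) <= mu(u) + t beta for every
    convex u that is 1-Lipschitz for the sup norm.  Applied to the function
    max(|x| - r, 0), which vanishes on the box, this bounds P(|X_t| > r + 1) by
    t beta.  Summing over t gives T^2 beta, and since a probability is at most 1
    the bound min(1, T^2 beta) <= T sqrt beta is linear in T.

    The probability of the next sign depends on the revealed vectors and on the
    current position.  For a single test function u the best choice is the sign
    with the smaller value of u, so what matters is the average of
    min(u(x + a), u(x - a)).  One choice that serves all u at once exists by a
    minimax argument ([cube_minimax], [good_kernel_exists]): the test functions
    form a convex set, the choices form a compact one.  The resulting walk is
    run from a single uniform seed by cutting [0, 1] into nested intervals.

    The function min(u(x + a), u(x - a)) is not convex.  It is replaced by the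
    convex majorant [window_inf u a], the functional form of the operation by
    which Banaszczyk extends a convex body in direction a wherever its chords
    are long enough.  It remains to see that mu(window_inf u a) exceeds mu(u) by
    at most beta.  Along a line of direction a the majorant exceeds u only near
    the minimum of u, and there the excess is at most twice the gain at any
    point at least three steps away ([window_inf_pos_neg_norm]).  Hence a point
    x is harmless as soon as, at each of the distances 3, 6, 9, 12, one of the
    two points x + j a, x - j a has at least half the density of x
    ([sum_window_inf_le]).

    The measure mu is a product of densities exp(- potential), taken on a fine
    grid to which the steps are rounded.  For a product, the ratio of the
    density at x + j a times the density at x - j a to the square of the density
    at x is exp(- sum of second differences of the potential), a sum over the at
    most d coordinates that a moves.  These second differences are nonnegative
    and independent, and a Chernoff bound ([sum_bad_le]) makes their sum at most
    1 outside an event of probability exp(- rate / 2).  The potential must exceed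
    d within a distance O(sqrt d), have bounded mean curvature at that scale,
    and satisfy rate * curvature <= potential / 4 + O(1), so that the
    exponential moment is under control.  It is a sum of squared distances with
    weights 16^j to intervals whose ends are 2^-j + 1/J apart, with J of order
    ln d levels.  The gaps 2^-j bound the mean curvature, the gaps 1/J allow
    rate = d / J^2, and all gaps add up to O(1).  This gives the exponent
    d / ln(e d)^2, hence the one with ln(e d)^(2 + eta). *)

(** * Convex Lipschitz functions and the window operation *)

Section ConvexLipschitz.
Context {R : realType} {V : normedModType R}.
Implicit Types (u : V -> R) (a x y : V) (s t : R).

Definition cvx_lip u : Prop :=
  (forall x y t, 0 <= t <= 1 ->
     u (t *: x + (1 - t) *: y) <= t * u x + (1 - t) * u y) /\
  (forall x y, u x - u y <= `|x - y|).

Lemma cvx_lipDc u c : cvx_lip u -> cvx_lip (fun x => u x + c).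
Proof.
move=> [cu lu]; split=> [x y t t01|x y].
- have := cu x y t t01; lra.
- by have := lu x y; lra.
Qed.

Lemma cvx_lip_sum (J : Type) (l : seq J) (w : J -> R) (u : J -> V -> R) :
  (forall j, 0 <= w j) -> \sum_(j <- l) w j = 1 -> (forall j, cvx_lip (u j)) ->
  cvx_lip (fun x => \sum_(j <- l) w j * u j x).
Proof.
move=> w0 w1 cu; split=> [x y t t01|x y].
- rewrite !mulr_sumr -big_split /=; apply: ler_sum => j _.
  rewrite !(mulrCA _ (w j)) -mulrDr; apply: ler_wpM2l => //.
  exact: (cu j).1.
- rewrite -sumrB -[leRHS]mul1r -w1 mulr_suml; apply: ler_sum => j _.
  by rewrite -mulrBr; apply: ler_wpM2l => //; exact: (cu j).2.
Qed.

Lemma cvx_lip_norm_excess r : 0 <= r -> cvx_lip (fun x => Num.max (`|x| - r) 0).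
Proof.
move=> r0; split=> [x y t /andP[t0 t1]|x y].
- have t1' : 0 <= 1 - t by lra.
  have h : `|t *: x + (1 - t) *: y| <= t * `|x| + (1 - t) * `|y|.
    rewrite (le_trans (ler_normD _ _)) // !normrZ.
    by rewrite (ger0_norm t0) (ger0_norm t1').
  have hx : t * (`|x| - r) <= t * Num.max (`|x| - r) 0.
    by rewrite ler_wpM2l // le_max lexx.
  have hy : (1 - t) * (`|y| - r) <= (1 - t) * Num.max (`|y| - r) 0.
    by rewrite ler_wpM2l // le_max lexx.
  have hx0 : 0 <= t * Num.max (`|x| - r) 0.
    by rewrite mulr_ge0 // le_max lexx orbT.
  have hy0 : 0 <= (1 - t) * Num.max (`|y| - r) 0.
    by rewrite mulr_ge0 // le_max lexx orbT.
  rewrite ge_max; apply/andP; split; last lra.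
  by move: hx hy; rewrite !mulrBr; lra.
- have h : `|x| - `|y| <= `|x - y| by exact: lerB_dist.
  have : `|y| - r <= Num.max (`|y| - r) 0 by rewrite le_max lexx.
  have : 0 <= Num.max (`|y| - r) 0 by rewrite le_max lexx orbT.
  move=> h1 h2; rewrite lerBlDl ge_max; apply/andP; split; first lra.
  by have := normr_ge0 (x - y); lra.
Qed.

Definition window_max u a s x := Num.max (u (x + (s - 1) *: a)) (u (x + (s + 1) *: a)).
Definition window_maxima u a x := [set window_max u a s x | s in `[-2, 2]%classic].
(** Each window has length two steps and is at most three steps away from x.
    Taking the infimum over all real s in [-2, 2], rather than over integers,
    is what preserves convexity. *)
Definition window_inf u a x := inf (window_maxima u a x).

Lemma window_max_lip u a s x y : cvx_lip u ->
  window_max u a s x - window_max u a s y <= `|x - y|.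
Proof.
move=> [_ lu]; rewrite /window_max.
have h1 : u (x + (s - 1) *: a) - u (y + (s - 1) *: a) <= `|x - y|.
  by rewrite (le_trans (lu _ _)) // opprD addrACA subrr addr0.
have h2 : u (x + (s + 1) *: a) - u (y + (s + 1) *: a) <= `|x - y|.
  by rewrite (le_trans (lu _ _)) // opprD addrACA subrr addr0.
have : u (y + (s - 1) *: a) <= Num.max (u (y + (s - 1) *: a)) (u (y + (s + 1) *: a)).
  by rewrite le_max lexx.
have : u (y + (s + 1) *: a) <= Num.max (u (y + (s - 1) *: a)) (u (y + (s + 1) *: a)).
  by rewrite le_max lexx orbT.
by move=> g1 g2; rewrite lerBlDl ge_max; apply/andP; split; lra.
Qed.

Lemma window_maxima_neq0 u a x : window_maxima u a x !=set0.
Proof. by exists (window_max u a 0 x); exists 0 => //=; rewrite in_itv /=; apply/andP; split; lra. Qed.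

Lemma cvx_line_le_max u a x r s t : cvx_lip u -> r <= s <= t ->
  u (x + s *: a) <= Num.max (u (x + r *: a)) (u (x + t *: a)).
Proof.
move=> [cu _] /andP[rs st].
have [rt|rt] := eqVneq r t.
  have -> : s = r by lra.
  by rewrite le_max lexx.
have tr : 0 < t - r by rewrite subr_gt0 lt_neqAle rt (le_trans rs).
set p := (t - s) / (t - r).
have p0 : 0 <= p by apply: divr_ge0; [rewrite subr_ge0|exact: ltW].
have p1 : p <= 1 by rewrite ler_pdivrMr // mul1r; lra.
have e : x + s *: a = p *: (x + r *: a) + (1 - p) *: (x + t *: a).
  rewrite !scalerDr !scalerA addrACA -!scalerDl addrC.
  have -> : p * r + (1 - p) * t = s by rewrite /p; field; rewrite gt_eqF.
  by rewrite (addrC p) subrK scale1r addrC.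
rewrite e; apply: le_trans (cu _ _ _ _) _; first by rewrite p0.
set A := u (x + r *: a); set B := u (x + t *: a).
have hA : p * A <= p * Num.max A B by rewrite ler_wpM2l // le_max lexx.
have hB : (1 - p) * B <= (1 - p) * Num.max A B.
  by rewrite ler_wpM2l ?le_max ?lexx ?orbT //; lra.
lra.
Qed.

Lemma min_le_window_max u a s x : cvx_lip u -> -2 <= s <= 2 ->
  Num.min (u (x + a)) (u (x - a)) <= window_max u a s x.
Proof.
move=> cu /andP[s1 s2]; rewrite ge_min /window_max.
have [s0|s0] := leP 0 s.
  by apply/orP; left; rewrite -{1}[a]scale1r; apply: cvx_line_le_max => //; apply/andP; split; lra.
apply/orP; right; rewrite -scaleN1r.
by apply: cvx_line_le_max => //; apply/andP; split; lra.
Qed.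

Lemma window_maxima_lb u a x : cvx_lip u ->
  lbound (window_maxima u a x) (Num.min (u (x + a)) (u (x - a))).
Proof. by move=> cu _ [s /= /[!in_itv]/= s2 <-]; exact: min_le_window_max. Qed.

(** Every admissible window contains x + a or x - a. *)
Lemma window_inf_ge u a x : cvx_lip u -> Num.min (u (x + a)) (u (x - a)) <= window_inf u a x.
Proof.
by move=> cu; apply: lb_le_inf; [exact: window_maxima_neq0|exact: window_maxima_lb].
Qed.

Lemma window_inf_le u a x s : cvx_lip u -> -2 <= s <= 2 -> window_inf u a x <= window_max u a s x.
Proof.
move=> cu s2; apply: ge_inf; first by eexists; exact: window_maxima_lb.
by exists s => //=; rewrite in_itv.
Qed.

Lemma window_inf_approx u a x e : cvx_lip u -> 0 < e ->
  exists s, -2 <= s <= 2 /\ window_max u a s x < window_inf u a x + e.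
Proof.
move=> cu e0.
have hi : has_inf (window_maxima u a x).
  by split; [exact: window_maxima_neq0|eexists; exact: window_maxima_lb].
have [_ [s /= s2 <-] h] := inf_adherent e0 hi.
by exists s; split=> //; move: s2; rewrite in_itv.
Qed.

(** The maximum over a window is jointly convex in x and in the position s of
    the window, and a partial infimum of a jointly convex function is convex. *)
Lemma cvx_lip_window_inf u a : cvx_lip u -> cvx_lip (window_inf u a).
Proof.
move=> cu; split=> [x y t /andP[t0 t1]|x y].
- apply/ler_addgt0Pr => e e0.
  have [r [/andP[r1 r2] hr]] := window_inf_approx a x cu e0.
  have [s [/andP[s1 s2] hs]] := window_inf_approx a y cu e0.
  have t1' : 0 <= 1 - t by lra.
  apply: (@le_trans _ _ (window_max u a (t * r + (1 - t) * s) (t *: x + (1 - t) *: y))).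
    by apply: window_inf_le => //; apply/andP; split; nra.
  apply: (@le_trans _ _ (t * window_max u a r x + (1 - t) * window_max u a s y)); last first.
    have /(ler_wpM2l t0) := ltW hr; have /(ler_wpM2l t1') := ltW hs; lra.
  have key c : u (t *: x + (1 - t) *: y + (t * r + (1 - t) * s + c) *: a)
      <= t * u (x + (r + c) *: a) + (1 - t) * u (y + (s + c) *: a).
    have -> : t *: x + (1 - t) *: y + (t * r + (1 - t) * s + c) *: a =
      t *: (x + (r + c) *: a) + (1 - t) *: (y + (s + c) *: a).
      rewrite !scalerDr !scalerA addrACA -!scalerDl; congr (_ + _ *: _); ring.
    by apply: cu.1; rewrite t0.
  rewrite {1}/window_max ge_max; apply/andP; split; apply: le_trans (key _) _;
    by apply: lerD; apply: ler_wpM2l => //; rewrite le_max lexx ?orbT.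
- rewrite lerBlDr; apply/ler_addgt0Pr => e e0.
  have [s [s2 hs]] := window_inf_approx a y cu e0.
  have := window_max_lip a s x y cu.
  have := @window_inf_le u a x s cu s2; lra.
Qed.

(** If the windows [0, 2] and [-2, 0] do not bring u below u(x), then u grows
    beyond distance 2 on both sides, with slope at least half the excess at x.
    Far enough away the window reaching back to distance t - 1 therefore gains
    a full step of that slope. *)
Lemma window_inf_pos_neg u a x t : cvx_lip u -> u x < window_inf u a x -> 3 <= t ->
  window_inf u a (x + t *: a) - u (x + t *: a) <= - ((window_inf u a x - u x) / 2).
Proof.
move=> cu pos t3.
have h2 : window_inf u a x <= u (x + 2 *: a).
  have := @window_inf_le u a x 1 cu; rewrite /window_max subrr scale0r addr0.
  have -> : 1 + 1 = 2 :> R by ring.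
  have i : -2 <= (1 : R) <= 2 by apply/andP; split; lra.
  by move=> /(_ i); rewrite le_max leNgt pos.
have mono r : 2 <= r -> u x <= u (x + r *: a).
  move=> r2; have := @cvx_line_le_max u a x 0 2 r cu.
  rewrite scale0r addr0 => H; have {}H := H ltac:(by apply/andP; split; lra).
  move: H; rewrite le_max => /orP[|H]; first lra.
  lra.
have h3 : window_inf u a (x + t *: a) <= u (x + (t - 1) *: a).
  have := @window_inf_le u a (x + t *: a) (-2) cu; rewrite /window_max -!addrA -!scalerDl.
  have i : -2 <= (-2 : R) <= 2 by apply/andP; split; lra.
  move=> /(_ i) /le_trans; apply.
  have -> : t + (-2 - 1) = t - 3 by ring.
  have -> : t + (-2 + 1) = t - 1 by ring.
  rewrite ge_max lexx andbT.
  have := @cvx_line_le_max u a x 0 (t - 3) (t - 1) cu.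
  rewrite scale0r addr0 => H; have {}H := H ltac:(by apply/andP; split; lra).
  apply: le_trans H _; rewrite ge_max lexx andbT; apply: mono; lra.
have i : 0 < t by lra.
(* the slope on [t - 1, t] is at least the slope on [0, 2] *)
have c1 : u (x + (t - 1) *: a) <= t^-1 * u x + (1 - t^-1) * u (x + t *: a).
  have -> : x + (t - 1) *: a = t^-1 *: x + (1 - t^-1) *: (x + t *: a).
    rewrite scalerDr scalerA addrA -scalerDl (addrC t^-1) subrK scale1r.
    by congr (_ + _ *: _); field; rewrite gt_eqF.
  apply: cu.1; rewrite invr_ge0 ltW //= invf_le1 //; lra.
have c2 : u (x + 2 *: a) <= (1 - 2 * t^-1) * u x + (2 * t^-1) * u (x + t *: a).
  have -> : x + 2 *: a = (1 - 2 * t^-1) *: x + (1 - (1 - 2 * t^-1)) *: (x + t *: a).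
    rewrite scalerDr scalerA addrA -scalerDl (addrC _ (1 - (1 - _))) subrK scale1r.
    by congr (_ + _ *: _); field; rewrite gt_eqF.
  have -> : 2 * t^-1 * u (x + t *: a) = (1 - (1 - 2 * t^-1)) * u (x + t *: a) by ring.
  have h : 2 * t^-1 <= 1 by rewrite ler_pdivrMr // mul1r; lra.
  apply: cu.1; rewrite subr_ge0 h /= gerBl mulr_ge0 // invr_ge0 ltW //.
move: (t^-1) c1 c2 => q; lra.
Qed.

Lemma window_maxN u a s x : window_max u (- a) s x = window_max u a (- s) x.
Proof.
rewrite /window_max maxC !scalerN -!scaleNr.
by congr (Num.max (u (_ + _ *: _)) (u (_ + _ *: _))); ring.
Qed.

Lemma window_infN u a x : window_inf u (- a) x = window_inf u a x.
Proof.
have sub b : window_maxima u (- b) x `<=` window_maxima u b x.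
  move=> _ [s /= /[!in_itv]/= /andP[s1 s2] <-]; exists (- s : R).
    by rewrite /= in_itv /=; apply/andP; split; lra.
  by rewrite window_maxN.
rewrite /window_inf; congr (inf _); apply/seteqP; split; first exact: sub.
by have := sub (- a); rewrite opprK.
Qed.

Lemma window_inf_pos_neg_norm u a x t : cvx_lip u -> u x < window_inf u a x -> 3 <= `|t| ->
  window_inf u a (x + t *: a) - u (x + t *: a) <= - ((window_inf u a x - u x) / 2).
Proof.
move=> cu pos; have [t0|t0] := leP 0 t; first by rewrite ger0_norm //; exact: window_inf_pos_neg.
rewrite ltr0_norm // => h.
have := @window_inf_pos_neg u (- a) x (- t) cu; rewrite !window_infN scalerN -scaleNr opprK.
by apply.
Qed.

Lemma window_inf_le_norm u a x : cvx_lip u -> window_inf u a x <= u x + `|a|.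
Proof.
move=> cu; have := @window_inf_le u a x 0 cu.
have i : -2 <= (0 : R) <= 2 by apply/andP; split; lra.
move=> /(_ i) /le_trans; apply; rewrite /window_max sub0r add0r scaleN1r scale1r.
by rewrite ge_max -!lerBlDl; apply/andP; split;
  rewrite (le_trans (cu.2 _ _)) // addrAC subrr add0r ?normrN.
Qed.

End ConvexLipschitz.

(** * Averages of the window operation *)

Section WindowAverage.
Context {R : realType} {V : normedModType R} {I : finType}.
Variables (f : I -> R) (pos : I -> V) (u : V -> R) (a : V) (bad : pred I).

(** A good point where [window_inf] exceeds u charges a quarter of its excess to
    each of four points of its line.  Offsets that are distinct multiples of 3
    differ by at least 3, so two points charging the same target would lie at
    distance at least three on a line and could not both have an excess: every
    target is charged once.  The factor 4 is the product of the density ratio 2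
    and of the factor 2 between excess and gain. *)
Lemma sum_window_inf_le :
  (forall x, 0 <= f x) -> injective pos -> cvx_lip u -> `|a| <= 1 ->
  (forall x, ~~ bad x -> forall k : 'I_4, exists (y : I) (z : int),
     [/\ `|z|%N = k.+1, pos y = pos x + (3 * z%:~R) *: a & f x <= 2 * f y]) ->
  \sum_x f x * window_inf u a (pos x) <=
  \sum_x f x * u (pos x) + \sum_(x | bad x) f x.
Proof.
move=> f0 posI cu a1 good.
pose r x := window_inf u a (pos x) - u (pos x).
have r1 x : r x <= 1 by have := window_inf_le_norm a (pos x) cu; rewrite /r; lra.
have rneg x y (t : R) : 0 < r x -> pos y = pos x + t *: a -> 3 <= `|t| ->
    r y <= - (r x / 2).
  by move=> + e t3; rewrite /r e subr_gt0 => rx; exact: window_inf_pos_neg_norm.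
suff h : \sum_x f x * r x <= \sum_(x | bad x) f x.
  rewrite -lerBlDl -sumrB; apply: le_trans h; apply: ler_sum => x _.
  by rewrite /r mulrBr.
pose P := [set x | (0 < r x) && ~~ bad x]%SET.
have split_sum : \sum_x f x * r x <=
   \sum_(x in P) f x * r x + \sum_(x | bad x) f x + \sum_(x | r x < 0) f x * r x.
  rewrite [X in X + _ + _]big_mkcond [X in _ + X + _]big_mkcond.
  rewrite [X in _ <= _ + X]big_mkcond -!big_split /=; apply: ler_sum => x _.
  rewrite inE; have := f0 x; have := r1 x.
  have [rx|rx|rx] := ltgtP (r x) 0; case: (bad x) => /= h1 h2; nra.
suff h : \sum_(x in P) f x * r x <= - \sum_(x | r x < 0) f x * r x by lra.
(* the targets charged by a good point *)
have /choice [y hy] : forall p : I * 'I_4, exists y : I, p.1 \in P ->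
    exists z : int, [/\ `|z|%N = p.2.+1,
      pos y = pos p.1 + (3 * z%:~R) *: a & f p.1 <= 2 * f y].
  move=> [x k] /=; have [xP|xP] := boolP (x \in P); last by exists x.
  move: xP; rewrite inE => /andP[_ /good /(_ k)[y [z hz]]].
  by exists y => _; exists z.
have far (z z' : int) : z != z' -> 3 <= `|3 * z%:~R - 3 * z'%:~R| :> R.
  move=> zz'; rewrite -mulrBr normrM ger0_norm // ler_peMr // -intrB -intr_norm.
  by rewrite (ler_int _ 1) -gtz0_ge1 normr_gt0 subr_eq0.
have charge p : p.1 \in P -> r (y p) < 0 /\ f p.1 * r p.1 <= 4 * - (f (y p) * r (y p)).
  move=> pP; have [z [zk yz fy]] := hy _ pP.
  have rp : 0 < r p.1 by move: pP; rewrite inE => /andP[].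
  have z3 : 3 <= `|3 * z%:~R : R|.
    have := @far z 0; rewrite mulr0 subr0; apply.
    by apply/eqP => z0; move: zk; rewrite z0.
  have ry := rneg _ _ _ rp yz z3; have := f0 (y p); have := f0 p.1.
  by split; [lra|nra].
have yinj p q : p.1 \in P -> q.1 \in P -> y p = y q -> p = q.
  move=> pP qP e; have [z [zk yz _]] := hy _ pP.
  have [z' [zk' yz' _]] := hy _ qP.
  have rp : 0 < r p.1 by move: pP; rewrite !inE => /andP[].
  have rq : 0 < r q.1 by move: qP; rewrite !inE => /andP[].
  have e' : pos q.1 = pos p.1 + (3 * z%:~R - 3 * z'%:~R) *: a.
    by rewrite scalerBl addrA -yz e yz' addrK.
  have [zz'|zz'] := eqVneq z z'.
    move: e'; rewrite zz' subrr scale0r addr0 => /posI pq.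
    have k12 : p.2 = q.2 by apply/val_inj/succn_inj; rewrite -zk -zk' zz'.
    by rewrite [p]surjective_pairing [q]surjective_pairing pq k12.
  have h := rneg _ _ _ rp e' (far _ _ zz').
  by exfalso; clear - h rp rq; lra.
pose G z := if r z < 0 then - (f z * r z) else 0.
have G0 z : 0 <= G z.
  by rewrite /G; case: ifP => // rz; have := f0 z; nra.
have -> : - \sum_(x | r x < 0) f x * r x = \sum_x G x.
  by rewrite -sumrN big_mkcond.
pose Q := [set p : I * 'I_4 | p.1 \in P]%SET.
have -> : \sum_(x in P) f x * r x = \sum_(p in Q) f p.1 * r p.1 / 4.
  rewrite (eq_bigl (fun p : I * 'I_4 => (p.1 \in P) && true)); last first.
    by move=> p; rewrite inE andbT.
  rewrite -(pair_big (mem P) xpredT (fun x (_ : 'I_4) => f x * r x / 4)) /=.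
  apply: eq_bigr => x _; rewrite sumr_const card_ord -[RHS]mulr_natr.
  by rewrite mulfVK.
apply: (@le_trans _ _ (\sum_(p in Q) G (y p))).
  apply: ler_sum => p; rewrite inE => /charge[ry c].
  by rewrite /G ry ler_pdivrMr //; lra.
rewrite -(big_imset G (h := y)) /=; last first.
  by move=> p q /[1!inE] pP /[1!inE] qP; exact: yinj.
rewrite [leRHS](bigID (mem (y @: Q))) /= lerDl; exact: sumr_ge0.
Qed.

End WindowAverage.

(** * A minimax principle on the cube *)

Section Minimax.
Context {R : realType} {I : choiceType}.

HB.instance Definition _ := isPointed.Build {ptws I -> R} (fun=> 0).

Definition cube : set {ptws I -> R} := [set p | forall i, 0 <= p i <= 1].

Lemma compact_cube : compact cube.
Proof.
have := @tychonoff I (fun=> R) (fun=> `[0, 1]%classic) (fun=> @segment_compact R 0 1).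
by congr compact; apply/seteqP; split=> p /= h i; have := h i; rewrite /= in_itv.
Qed.

Lemma cvg_eval (i : I) (p : {ptws I -> R}) : (q i) @[q --> p] --> p i.
Proof. exact: (@proj_continuous I (fun=> R) i p). Qed.

(** A minimiser p of the sum of the squared positive parts of the [L j] works:
    otherwise the positive parts, normalised, are weights for which the first
    order condition at p contradicts the hypothesis. *)
Lemma finite_minimax (J : eqType) (s : seq J) (L : J -> {ptws I -> R} -> R) :
  (forall j, continuous (L j)) ->
  (forall j (p q : {ptws I -> R}) (t : R),
     L j (fun i => (1 - t) * p i + t * q i) = (1 - t) * L j p + t * L j q) ->
  (forall w : J -> R, (forall j, 0 <= w j) -> \sum_(j <- s) w j = 1 ->
     exists2 p, cube p & \sum_(j <- s) w j * L j p <= 0) ->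
  exists2 p, cube p & forall j, j \in s -> L j p <= 0.
Proof.
move=> cL affL H.
pose phi p := \sum_(j <- s) (Num.max (L j p) 0) ^+ 2.
have cphi : continuous phi.
  apply: (@continuous_big _ _ +%R) => // [|j _ p]; first exact: add_continuous.
  apply: (@continuous_comp _ _ _ (fun q => Num.max (L j q) 0) (fun x : R => x ^+ 2)).
    by apply: (@continuous_max _ _ (L j) (fun=> 0)); [exact: cL|exact: cst_continuous].
  exact: exprn_continuous.
have cube0 : cube !=set0 by exists (fun=> 0) => i; rewrite lexx ler01.
have [p /set_mem cp minp] := compact_EVT_min cube0 compact_cube (continuous_subspaceT cphi).
exists p => // j0 j0s.
pose m j := Num.max (L j p) 0.
have m0 j : 0 <= m j by rewrite /m le_max lexx orbT.
rewrite leNgt; apply/negP => Lj0.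
have M0 : 0 < \sum_(j <- s) m j.
  apply: (lt_le_trans Lj0); apply: (@le_trans _ _ (m j0)); first by rewrite /m le_max lexx.
  by rewrite (big_rem _ j0s) /= lerDl sumr_ge0.
set M := \sum_(j <- s) m j in M0.
have [||q cq] := H (fun j => m j / M).
- by move=> j; rewrite divr_ge0 // ltW.
- by rewrite -mulr_suml divff // gt_eqF.
under eq_bigr do rewrite mulrAC.
rewrite -mulr_suml pmulr_lle0 ?invr_gt0 // => hq.
pose D := \sum_(j <- s) (L j q - L j p) ^+ 2.
pose G := \sum_(j <- s) m j * (L j q - L j p).
have D0 : 0 <= D by apply: sumr_ge0 => j _; exact: sqr_ge0.
have G0 : G < 0.
  have : 0 < \sum_(j <- s) m j * L j p.
    apply: (@lt_le_trans _ _ (m j0 * L j0 p)).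
      by rewrite mulr_gt0 // /m lt_max Lj0.
    rewrite (big_rem _ j0s) /= lerDl sumr_ge0 // => j _.
    by rewrite /m; case: (leP (L j p) 0) => h; [rewrite mul0r|rewrite mulr_ge0 // ltW].
  have -> : G = \sum_(j <- s) m j * L j q - \sum_(j <- s) m j * L j p.
    by rewrite -sumrB; apply: eq_bigr => j _; rewrite mulrBr.
  lra.
(* a step towards q short enough for the linear term G to dominate *)
pose t := Num.min 1 (- G / (D + 1)).
have t0 : 0 < t by rewrite lt_min ltr01 divr_gt0 //; lra.
have t1 : t <= 1 by rewrite ge_min lexx.
have tD : t * D <= - G.
  have : t * (D + 1) <= - G by rewrite -ler_pdivlMr ?ge_min ?lexx ?orbT //; lra.
  nra.
pose z : {ptws I -> R} := fun i => (1 - t) * p i + t * q i.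
have cz : cube z.
  by move=> i; have /andP[? ?] := cp i; have /andP[? ?] := cq i; apply/andP; split; rewrite /z; nra.
have := minp z (mem_set cz).
have : phi z <= phi p + 2 * t * G + t ^+ 2 * D.
  rewrite /phi /G /D !mulr_sumr -!big_split /=; apply: ler_sum => j _.
  rewrite /z affL -/(m j) /=; have := m0 j.
  have : L j p <= m j by rewrite /m le_max lexx.
  move: (L j p) (L j q) (m j) => x y k xk k0.
  have -> : (1 - t) * x + t * y = x + t * (y - x) by ring.
  apply: (@le_trans _ _ ((k + t * (y - x)) ^+ 2)); last by lra.
  by case: (leP (x + t * (y - x)) 0) => h; [rewrite expr0n /= sqr_ge0|rewrite ler_sqr ?nnegrE; lra].
nra.
Qed.

(** By compactness, finitely many constraints at a time suffice. *)
Lemma cube_minimax (J : choiceType) (U : set J) (L : J -> {ptws I -> R} -> R) :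
  (forall j, continuous (L j)) ->
  (forall j (p q : {ptws I -> R}) (t : R),
     L j (fun i => (1 - t) * p i + t * q i) = (1 - t) * L j p + t * L j q) ->
  (forall (s : seq J) (w : J -> R), (forall j, j \in s -> U j) ->
     (forall j, 0 <= w j) -> \sum_(j <- s) w j = 1 ->
     exists2 p, cube p & \sum_(j <- s) w j * L j p <= 0) ->
  exists2 p, cube p & forall j, U j -> L j p <= 0.
Proof.
move=> cL affL H.
have := compact_cube; rewrite compact_In0 => /(_ J U (fun j => cube `&` L j @^-1` [set x | x <= 0])).
case.
- exists (fun j => L j @^-1` [set x | x <= 0]) => // j _.
  by apply: closed_comp; [move=> p _; exact: cL|exact: closed_le].
- move=> s sU; have [||w w0 w1|p cp hp] := @finite_minimax J (finmap.enum_fset s) L.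
  + exact: cL.
  + exact: affL.
  + by apply: H => // j /sU /set_mem.
  by exists p => j /= js; split=> //=; exact: hp.
move=> p hp; have [[j Uj]|nU] := pselect (exists j, U j).
  by exists p => [|k Uk]; have [] := hp _ ltac:(eassumption).
exists (fun=> 0) => [i|j Uj]; first by rewrite lexx ler01.
by exfalso; apply: nU; exists j.
Qed.

End Minimax.

(** * The online walk driven by one uniform seed *)

Section RandomWalk.
Context {R : realType} {n : nat}.
Notation V := 'rV[R]_n.
Variables (b : (V -> R) -> R) (W : set V) (beta : R).

(** An atom (lo, wd, x) stands for the seeds in [lo, lo + wd], which, up to end
    points, lead to the position x; thus wd is the probability of the atom. *)
Definition atom : Type := R * R * V.
Implicit Types (s : atom) (p : V -> R) (a : V) (l : seq atom) (h : seq V).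

Definition cut p s : R := s.1.1 + p s.2 * s.1.2.
Definition left_atom p a s : atom := (s.1.1, p s.2 * s.1.2, s.2 + a).
Definition right_atom p a s : atom := (cut p s, (1 - p s.2) * s.1.2, s.2 - a).
Definition split_atoms p a l : seq atom :=
  flatten [seq [:: left_atom p a s; right_atom p a s] | s <- l].

Definition mean l (u : V -> R) : R := \sum_(s <- l) s.1.2 * u s.2.

(** A position x moves to x + a with probability [p x]; the kernel is good when
    the new law still lies below b, up to c, on all test functions. *)
Definition good_kernel a l c : set {ptws V -> R} :=
  [set p | cube p /\ forall u, cvx_lip u -> mean (split_atoms p a l) u <= b u + c].
Definition kernel a l c : V -> R := xget (fun=> 0) (good_kernel a l c).

(** Histories are listed with the latest vector first. *)
Fixpoint atoms h : seq atom :=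
  if h is a :: h' then
    split_atoms (kernel a (atoms h') ((size h)%:R * beta)) a (atoms h')
  else [:: (0, 1, 0)].

Definition kernel_at a h' := kernel a (atoms h') ((size h').+1%:R * beta).

Fixpoint walk h (w : R) : atom :=
  if h is a :: h' then
    let p := kernel_at a h' in let s := walk h' w in
    if w < cut p s then left_atom p a s else right_atom p a s
  else (0, 1, 0).

Definition sign_of h (w : R) : bool :=
  if h is a :: h' then cut (kernel_at a h') (walk h' w) <= w else false.

Lemma walk_cons a h w :
  (walk (a :: h) w).2 = (walk h w).2 + (-1) ^+ sign_of (a :: h) w *: a.
Proof.
rewrite /=; case: ltP => _ /=; first by rewrite expr0 scale1r.
by rewrite expr1 scaleN1r.
Qed.

Lemma big_split_atoms (S : nmodType) p a l (F : atom -> S) :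
  \sum_(s <- split_atoms p a l) F s =
  \sum_(s <- l) (F (left_atom p a s) + F (right_atom p a s)).
Proof.
rewrite /split_atoms big_flatten big_map; apply: eq_bigr => s _.
by rewrite big_cons big_seq1.
Qed.

Lemma mean_split p a l u : mean (split_atoms p a l) u =
  \sum_(s <- l) s.1.2 * (p s.2 * u (s.2 + a) + (1 - p s.2) * u (s.2 - a)).
Proof. by rewrite /mean big_split_atoms; apply: eq_bigr => s _ /=; ring. Qed.

Lemma kernel_cube a l c x : 0 <= kernel a l c x <= 1.
Proof.
rewrite /kernel; case: xgetP => [_ -> [+ _]|_]; first exact.
by rewrite lexx ler01.
Qed.

Lemma atoms_width_ge0 h s : s \in atoms h -> 0 <= s.1.2.
Proof.
elim: h s => [|a h IH] s /=; first by rewrite inE => /eqP ->.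
move=> /flattenP[_ /mapP[t /IH t0 ->]].
have /andP[p0 p1] := kernel_cube a (atoms h) ((size h).+1%:R * beta) t.2.
by rewrite !inE => /orP[] /eqP -> /=; rewrite mulr_ge0 // subr_ge0.
Qed.

(** The functional b is integration against the dominating measure, and W is the
    set of vectors the adversary may use. *)
Hypothesis b_sum : forall (s : seq (V -> R)) (w : (V -> R) -> R),
  b (fun x => \sum_(u <- s) w u * u x) = \sum_(u <- s) w u * b u.
Hypothesis b_ge0 : forall u, cvx_lip u -> u 0 <= b u.
Hypothesis b_step : forall a u, W a -> cvx_lip u -> exists v, [/\ cvx_lip v,
  forall x, Num.min (u (x + a)) (u (x - a)) <= v x & b v <= b u + beta].

(** For a fixed convex combination of test functions, moving deterministically
    to the smaller value is good by [b_step]; the minimax principle exchanges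
    the quantifiers. *)
Lemma good_kernel_exists a l c : W a -> (forall s, s \in l -> 0 <= s.1.2) ->
  (forall u, cvx_lip u -> mean l u <= b u + c) ->
  good_kernel a l (c + beta) !=set0.
Proof.
move=> Wa l0 hl.
pose L (u : {classic (V -> R)}) (p : {ptws V -> R}) := mean (split_atoms p a l) u - (b u + (c + beta)).
have [u|u p q t|us w usU w0 w1|p cp hp] := @cube_minimax R V {classic (V -> R)} cvx_lip L.
- have -> : L u = (fun p : {ptws V -> R} => \sum_(s <- l)
      s.1.2 * (p s.2 * u (s.2 + a) + (1 - p s.2) * u (s.2 - a)) - (b u + (c + beta))).
    by apply: funext => p; rewrite /L mean_split.
  move=> p; apply: (@continuousB _ _ _ _ (fun=> b u + (c + beta))); last exact: cst_continuous.
  apply: (@continuous_big _ _ +%R) => // [|s _ q]; first exact: add_continuous.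
  have -> : (fun q : {ptws V -> R} => s.1.2 * (q s.2 * u (s.2 + a) + (1 - q s.2) * u (s.2 - a))) =
      (fun q => (s.1.2 * (u (s.2 + a) - u (s.2 - a))) * q s.2 + s.1.2 * u (s.2 - a)).
    by apply: funext => q'; ring.
  set k := s.1.2 * (_ - _); set m := s.1.2 * _.
  apply: (@continuousD R R^o {ptws V -> R} (fun q => k * q s.2) (fun=> m)); last exact: cst_continuous.
  apply: (@continuousM R {ptws V -> R} (fun=> k) (fun q => q s.2)); first exact: cst_continuous.
  exact: cvg_eval.
- rewrite /L; set r := fun _ => _.
  have -> : mean (split_atoms r a l) u =
      (1 - t) * mean (split_atoms p a l) u + t * mean (split_atoms q a l) u.
    rewrite !mean_split !mulr_sumr -big_split /=; apply: eq_bigr => s _.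
    by rewrite /r; ring.
  ring.
- pose u x := \sum_(j <- us) w j * j x.
  have cu : cvx_lip u.
    have e : u = fun x => \sum_(j <- us) (if j \in us then w j else 0) *
        (if j \in us then j else fun=> 0) x.
      by apply: funext => x; rewrite /u !big_seq; apply: eq_bigr => j ->.
    rewrite e; apply: cvx_lip_sum => [j||j].
    - by case: ifP.
    - by rewrite -w1 [RHS]big_seq [LHS]big_seq; apply: eq_bigr => j ->.
    - case: ifP => [/usU//|_]; split=> [x y t _|x y].
        by rewrite !mulr0 addr0.
      by rewrite subrr.
  have [v [cv hv bv]] := b_step Wa cu.
  pose p x : R := if u (x + a) <= u (x - a) then 1 else 0.
  exists p; first by move=> x; rewrite /p; case: ifP; rewrite lexx ler01.
  have -> : \sum_(j <- us) w j * L j p = mean (split_atoms p a l) u - (b u + (c + beta)).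
    rewrite /L; under eq_bigr do rewrite mulrBr; rewrite sumrB; congr (_ - _).
      rewrite /mean; under eq_bigr do rewrite mulr_sumr.
      rewrite exchange_big /=; apply: eq_bigr => s _.
      by rewrite /u mulr_sumr; apply: eq_bigr => j _; ring.
    under eq_bigr do rewrite mulrDr; rewrite big_split /= -mulr_suml w1 mul1r.
    by rewrite -b_sum.
  have : mean (split_atoms p a l) u <= mean l v.
    rewrite mean_split /mean big_seq [leRHS]big_seq; apply: ler_sum => s sl.
    apply: ler_wpM2l; first exact: l0.
    apply: le_trans (hv _); rewrite /p /=; case: ifP => [h|/negbT].
      by rewrite min_l // mul1r subrr mul0r addr0.
    by rewrite -ltNge => /ltW h; rewrite min_r // mul0r add0r subr0 mul1r.
  have := hl v cv; lra.
- exists p; split=> // u cu.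
  by have := hp u cu; rewrite /L subr_le0.
Qed.

Lemma mean_atoms_le h u : (forall a, a \in h -> W a) -> cvx_lip u ->
  mean (atoms h) u <= b u + (size h)%:R * beta.
Proof.
elim: h u => [|a h IH] u Wh cu.
  by rewrite /mean /= big_seq1 mul1r mul0r addr0; exact: b_ge0.
have Wh' x : x \in h -> W x by move=> xh; apply: Wh; rewrite inE xh orbT.
have Wa : W a by apply: Wh; rewrite mem_head.
have := @good_kernel_exists a (atoms h) ((size h)%:R * beta) Wa
  (@atoms_width_ge0 h) (fun v => IH v Wh').
have -> : (size h)%:R * beta + beta = (size (a :: h))%:R * beta.
  by rewrite /= -natr1 mulrDl mul1r.
rewrite /= /kernel => -[p hp]; case: xgetP => [_ -> [_]|/(_ p)//].
exact.
Qed.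

Let U : probability _ R := uniform_prob (@ltr01 R).

(** Closed intervals overlap at their ends, which is harmless since only upper
    bounds on probabilities are needed. *)
Definition itv_of s : set R := `[s.1.1, s.1.1 + s.1.2]%classic.

Lemma uniform_itv_le s : 0 <= s.1.2 -> (U (itv_of s) <= (s.1.2)%:E)%E.
Proof.
move=> s0; rewrite /U /= /uniform_prob integral_uniform_pdf.
apply: (@le_trans _ _ (\int[lebesgue_measure]_(x in itv_of s) 1%:E)%E).
  apply: (@le_trans _ _ (\int[lebesgue_measure]_(x in itv_of s `&` `[0%R, 1%R]) 1%:E)%E).
    apply: ge0_le_integral => //=.
    - by apply: measurableI => //; exact: measurable_itv.
    - by move=> x _; rewrite lee_fin uniform_pdf_ge0.
    - by apply/measurable_EFinP/measurable_funTS; exact: measurable_uniform_pdf.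
    - move=> x [_]; rewrite /= in_itv /= /uniform_pdf => ->.
      by rewrite subr0 invr1.
  apply: ge0_subset_integral => //; first by apply: measurableI => //; exact: measurable_itv.
  exact: measurable_itv.
rewrite integral_cst /=; last exact: measurable_itv.
rewrite mul1e lebesgue_measure_itv /= lte_fin.
by case: ltP => _; [rewrite -EFinB lee_fin; lra|rewrite lee_fin].
Qed.

Lemma measurable_walk h (A : atom -> set R) : (forall s, measurable (A s)) ->
  measurable [set w | A (walk h w) w].
Proof.
elim: h A => [|a h IH] A mA; first exact: mA.
pose p := kernel_at a h.
have := IH (fun s => (A (left_atom p a s) `&` [set w | w < cut p s]) `|`
  (A (right_atom p a s) `&` [set w | cut p s <= w])).
have -> : [set w | A (walk (a :: h) w) w] = [set w |
   ((A (left_atom p a (walk h w)) `&` [set w' | w' < cut p (walk h w)]) `|`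
  (A (right_atom p a (walk h w)) `&` [set w' | cut p (walk h w) <= w'])) w].
  apply/seteqP; split=> w /=; rewrite -/p; case: ltP => h1.
  - by left.
  - by right.
  - by case=> [[]|[]].
  - by case=> [[]|[]].
apply=> s; apply: measurableU; apply: measurableI => //.
  by rewrite -set_itvNyo; exact: measurable_itv.
by rewrite -set_itvcy; exact: measurable_itv.
Qed.

(** The law of the walk is described by its atoms.  The set A may depend on the
    seed itself, because the induction moves the last comparison of the seed
    with a threshold into A. *)
Lemma uniform_walk_le h (A : atom -> set R) : (forall s, measurable (A s)) ->
  (U [set w | A (walk h w) w] <= \sum_(s <- atoms h) U (A s `&` itv_of s))%E.
Proof.
elim: h A => [|a h IH] A mA.
  rewrite /= big_seq1; set B := A _.
  have mI : measurable (itv_of (0, 1, 0)) by exact: measurable_itv.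
  have UI : U (~` itv_of (0, 1, 0)) = 0%E.
    rewrite probability_setC //.
    have -> : U (itv_of (0, 1, 0)) = 1%E.
      by rewrite /U /= /uniform_prob integral_uniform_pdf1 // /itv_of /= add0r.
    by rewrite subee.
  have -> : [set w | B w] = (B `&` itv_of (0, 1, 0)) `|` (B `&` ~` itv_of (0, 1, 0)).
    by rewrite -setIUr setUv setIT.
  have mB : measurable B by exact: mA.
  have mB1 : measurable (B `&` itv_of (0, 1, 0)) by exact: measurableI.
  have mB2 : measurable (B `&` ~` itv_of (0, 1, 0)).
    by apply: measurableI => //; exact: measurableC.
  apply: (le_trans (measureU2 U mB1 mB2)).
  rewrite -[leRHS]adde0 leeD2l // -UI; apply: le_measure; rewrite ?inE //.
  exact: measurableC.
pose p := kernel_at a h.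
pose A' s := (A (left_atom p a s) `&` [set w | w < cut p s]) `|`
  (A (right_atom p a s) `&` [set w | cut p s <= w]).
have mlt c : measurable [set w : R | w < c] by rewrite -set_itvNyo; exact: measurable_itv.
have mge c : measurable [set w : R | c <= w] by rewrite -set_itvcy; exact: measurable_itv.
have mA' s : measurable (A' s).
  by apply: measurableU; apply: measurableI.
have -> : [set w | A (walk (a :: h) w) w] = [set w | A' (walk h w) w].
  apply/seteqP; split=> w; rewrite /A' /= -/p; case: ltP => h1.
  - by left.
  - by right.
  - by case=> [[]|[]].
  - by case=> [[]|[]].
apply: le_trans (IH A' mA') _.
rewrite /= -/(kernel_at a h) -/p big_split_atoms; apply: lee_sum => s _.
have mI t : measurable (itv_of t) by exact: measurable_itv.
have mlr t : measurable (A t `&` itv_of t) by apply: measurableI.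
apply: le_trans (measureU2 U (mlr (left_atom p a s)) (mlr (right_atom p a s))).
apply: le_measure; [apply/mem_set; exact: (measurableI _ _ (mA' s) (mI s))|apply/mem_set; exact: (measurableU _ _ (mlr _) (mlr _))|].
move=> w [] [[Aw cw]|[Aw cw]]; rewrite /itv_of /= in_itv /= => /andP[w1 w2].
  by left; split => //; rewrite /= in_itv /= w1 ltW.
right; split => //; rewrite /= in_itv /= cw /= (le_trans w2) // /cut; lra.
Qed.

(** The test function max(|x| - r, 0) is at least 1 where |x| > r + 1. *)
Lemma uniform_walk_far h (r : R) : (forall a, a \in h -> W a) -> 0 <= r ->
  b (fun x => Num.max (`|x| - r) 0) <= 0 ->
  (U [set w | (r + 1 < `|(walk h w).2|)%R] <= ((size h)%:R * beta)%:E)%E.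
Proof.
move=> Wh r0 br.
pose F s : set R := if r + 1 < `|s.2| then setT else set0.
have -> : [set w | r + 1 < `|(walk h w).2|] = [set w | F (walk h w) w].
  by apply/seteqP; split=> w /=; rewrite /F; case: ifP.
apply: le_trans (uniform_walk_le h _) _.
  by move=> s; rewrite /F; case: ifP.
apply: (@le_trans _ _ (mean (atoms h) (fun x => Num.max (`|x| - r) 0))%:E).
  rewrite /mean -sumEFin big_seq [leRHS]big_seq; apply: lee_sum => s /atoms_width_ge0 s0.
  rewrite /F; case: ifP => hs; last first.
    by rewrite set0I measure0 lee_fin mulr_ge0 // le_max lexx orbT.
  rewrite setTI; apply: le_trans (uniform_itv_le s0) _.
  by rewrite lee_fin ler_peMr // le_max; apply/orP; left; lra.
rewrite lee_fin; apply: le_trans (mean_atoms_le Wh _) _; first exact: cvx_lip_norm_excess.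
lra.
Qed.

Lemma measurable_sign_of h : measurable_fun [set: R] (sign_of h).
Proof.
case: h => [|a h]; first exact: measurable_cst.
apply: (measurable_fun_bool true); rewrite setTI.
have := @measurable_walk h (fun s => [set w | cut (kernel_at a h) s <= w]); apply=> s.
by rewrite -set_itvcy; exact: measurable_itv.
Qed.

Definition walk_algorithm : online_algorithm R n :=
  @OnlineAlgorithm R n _ _ U (fun h w => sign_of (rev h) w)
    (fun h => measurable_sign_of (rev h)).

Lemma prefix_walk T (a : T.-tuple V) (w : R) (t : 'I_T) :
  \sum_(s < T | (s <= t)%N) (-1) ^+ @online_signs R n T walk_algorithm a w s *: tnth a s =
  (walk (rev (take t.+1 a)) w).2.
Proof.
have aux k : (k <= T)%N -> \sum_(s < T | (s < k)%N)
   (-1) ^+ @online_signs R n T walk_algorithm a w s *: tnth a s =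
   (walk (rev (take k a)) w).2.
  elim: k => [|k IH] kT; first by rewrite take0 /= big_pred0.
  have e : rev (take k.+1 a) = tnth a (Ordinal kT) :: rev (take k a).
    by rewrite (take_nth 0) ?size_tuple // rev_rcons (tnth_nth 0).
  rewrite e walk_cons -e (bigD1 (Ordinal kT)) //= addrC; congr (_ + _).
    rewrite -IH 1?ltnW //; apply: eq_bigl => s.
    by rewrite ltnS ltn_neqAle andbC.
  by rewrite ffunE /= e.
by rewrite -aux.
Qed.

Lemma walk_algorithm_far T (a : T.-tuple V) (r : R) :
  (forall t, W (tnth a t)) -> 0 <= r -> 0 <= beta ->
  b (fun x => Num.max (`|x| - r) 0) <= 0 ->
  let far := [set w |
    (r + 1 < max_prefix_norm a (@online_signs R n T walk_algorithm a w))%R] in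
  measurable far /\ (alg_prob walk_algorithm far <= (T%:R ^+ 2 * beta)%:E)%E.
Proof.
move=> Wa r0 be0 br far.
pose B k : set R := [set w | r + 1 < `|(walk (rev (take k.+1 a)) w).2|].
have mB k : measurable (B k).
  have := @measurable_walk (rev (take k.+1 a)) (fun s => if r + 1 < `|s.2| then setT else set0).
  rewrite (_ : [set w | _ w] = B k).
    by apply=> s; case: ifP.
  by apply/seteqP; split=> w /=; rewrite /B /=; case: ifP.
have -> : far = \big[setU/set0]_(k < T) B k.
  rewrite -bigcup_mkord; apply/seteqP; split=> w /=.
    rewrite /max_prefix_norm => /bigmax_gtP[|[t _]]; first lra.
    by rewrite prefix_walk => h; exists (t : nat); [exact: ltn_ord|exact: h].
  move=> [k kT Bk]; apply/bigmax_gtP; right; exists (Ordinal kT) => //.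
  by rewrite prefix_walk.
split; first by apply: bigsetU_measurable => k _; exact: mB.
apply: (le_trans (@Boole_inequality _ _ _ U B T (fun k _ => mB k))).
apply: (@le_trans _ _ (\sum_(k < T) (T%:R * beta)%:E)%E).
  apply: lee_sum => k _; apply: le_trans (uniform_walk_far _ r0 br) _.
    by move=> x; rewrite mem_rev => /mem_take /tnthP[t ->].
  rewrite lee_fin ler_wpM2r // ler_nat size_rev size_take size_tuple.
  by case: ifP => // _; exact: ltn_ord.
rewrite sumEFin sumr_const card_ord lee_fin -[_ *+ T]mulr_natl; lra.
Qed.

End RandomWalk.

(** * Product measures on a grid *)

Section SupNorm.
Context {R : realType} {n : nat}.
Implicit Types x : 'rV[R]_n.

Lemma rV_norm_le x (r : R) : 0 <= r -> (forall i, `|x 0 i| <= r) -> `|x| <= r.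
Proof.
move=> r0 h; have -> : `|x| = mx_norm x by [].
rewrite mx_normrE; apply/bigmax_leP; split=> //.
by move=> [i j] _ /=; rewrite (ord1 i).
Qed.

End SupNorm.

(** The coordinates of a random point are independent, with law proportional to
    [wt] on the grid of mesh 1/m in [-M/m, M/m].  The function D bounds the
    second differences of - ln wt for shifts up to 12, the largest shift used,
    and exceeds 1 within 12 of the ends of the box, so that good points can be
    shifted without leaving it. *)
Section ProductGrid.
Context {R : realType} {n : nat}.
Notation V := 'rV[R]_n.
Variables (M m : nat) (wt D : R -> R) (d : nat) (lam : R).
Hypothesis m_gt0 : (0 < m)%N.

Definition grid_coord (k : 'I_(2 * M).+1) : R := (k%:R - M%:R) / m%:R.
Definition grid_point := {ffun 'I_n -> 'I_(2 * M).+1}.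
Definition grid_pos (x : grid_point) : V := \row_i grid_coord (x i).
Definition mass : R := \sum_k wt (grid_coord k).
Definition density (x : grid_point) : R := \prod_i (wt (grid_coord (x i)) / mass).
Definition expect (u : V -> R) : R := \sum_x density x * u (grid_pos x).

Hypothesis wt_gt0 : forall x, 0 < wt x.
Hypothesis wt_even : forall x, wt (- x) = wt x.
Hypothesis D_ge0 : forall x, 0 <= D x.
Hypothesis D_shift : forall x t, `|t| <= 12 ->
  expR (- D x) * wt x ^+ 2 <= wt (x + t) * wt (x - t).
Hypothesis D_edge : forall k, M%:R / m%:R - 12 < `|grid_coord k| -> 1 < D (grid_coord k).
Hypothesis D_mgf : \sum_k wt (grid_coord k) * expR (lam * D (grid_coord k)) <=
  (1 + lam / (2 * d%:R)) * mass.
Hypothesis lam_gt0 : 0 < lam.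
Hypothesis d_gt0 : (0 < d)%N.

Let mR : 0 < m%:R :> R. Proof. by rewrite ltr0n. Qed.

Lemma grid_coord_inj : injective grid_coord.
Proof.
move=> k l /(congr1 (fun x => x * m%:R)); rewrite /grid_coord !divfK ?gt_eqF //.
by move=> /addIr /eqP; rewrite eqr_nat => /eqP /val_inj.
Qed.

Lemma grid_pos_inj : injective grid_pos.
Proof.
by move=> x y /rowP e; apply/ffunP => i; apply: grid_coord_inj; have := e i; rewrite !mxE.
Qed.

Lemma grid_coord_rev k : grid_coord (rev_ord k) = - grid_coord k.
Proof.
rewrite /grid_coord /= subSS natrB; last by rewrite -ltnS.
by rewrite natrM; field; rewrite gt_eqF.
Qed.

Lemma grid_coord_le k : `|grid_coord k| <= M%:R / m%:R.
Proof.
rewrite /grid_coord normrM normfV (gtr0_norm mR) ler_pM2r ?invr_gt0 //.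
have : (k%:R : R) <= (2 * M)%:R by rewrite ler_nat -ltnS.
have : 0 <= (k%:R : R) by rewrite ler0n.
by rewrite natrM ler_norml => h1 h2; apply/andP; split; lra.
Qed.

Lemma mass_gt0 : 0 < mass.
Proof.
by rewrite /mass big_ord_recl ltr_pwDl // sumr_ge0 // => k _; exact: ltW.
Qed.

Lemma density_ge0 x : 0 <= density x.
Proof. by apply: prodr_ge0 => i _; rewrite divr_ge0 // ltW // mass_gt0. Qed.

Lemma sum_prod (F : 'I_n -> 'I_(2 * M).+1 -> R) :
  \sum_(x : grid_point) \prod_i F i (x i) = \prod_i \sum_k F i k.
Proof. by rewrite (bigA_distr_bigA F). Qed.

Lemma sum_density : \sum_x density x = 1.
Proof.
rewrite /density (sum_prod (fun _ k => wt (grid_coord k) / mass)) big1 // => i _.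
by rewrite -mulr_suml divff // gt_eqF // mass_gt0.
Qed.

Lemma expect_sum (s : seq (V -> R)) (w : (V -> R) -> R) :
  expect (fun x => \sum_(u <- s) w u * u x) = \sum_(u <- s) w u * expect u.
Proof.
rewrite /expect; under eq_bigr do rewrite mulr_sumr.
rewrite exchange_big; apply: eq_bigr => u _; rewrite mulr_sumr.
by apply: eq_bigr => x _; rewrite mulrCA.
Qed.

(** Jensen's inequality at the barycentre, by symmetry of the measure. *)
Lemma expect_ge0 u : cvx_lip u -> u 0 <= expect u.
Proof.
move=> [cu _]; pose rv (x : grid_point) : grid_point := [ffun i => rev_ord (x i)].
have rvK : involutive rv by move=> x; apply/ffunP => i; rewrite !ffunE rev_ordK.
have e : expect u = \sum_x density x * u (- grid_pos x).
  rewrite /expect (reindex_inj (inv_inj rvK)); apply: eq_bigr => x _; congr (_ * u _).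
    by apply: eq_bigr => i _; rewrite ffunE grid_coord_rev wt_even.
  by apply/rowP => i; rewrite !mxE ffunE grid_coord_rev.
have : \sum_x density x * u 0 <= 2^-1 * (expect u + \sum_x density x * u (- grid_pos x)).
  rewrite /expect -big_split mulr_sumr; apply: ler_sum => x _.
  rewrite /= -mulrDr mulrCA; apply: ler_wpM2l; first exact: density_ge0.
  have := cu (grid_pos x) (- grid_pos x) 2^-1.
  have -> : 1 - 2^-1 = 2^-1 :> R by field.
  rewrite scalerN subrr => h; apply: le_trans (h _) _; last lra.
  by apply/andP; split; lra.
by rewrite -e -mulr_suml sum_density mul1r; lra.
Qed.

Lemma expect_norm_excess (r : R) : M%:R / m%:R <= r ->
  expect (fun x => Num.max (`|x| - r) 0) <= 0.
Proof.
move=> Mr; rewrite /expect big1 // => x _; rewrite max_r ?mulr0 // subr_le0.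
apply: rV_norm_le => [|i]; first by apply: le_trans Mr; rewrite divr_ge0.
by rewrite mxE (le_trans (grid_coord_le _)).
Qed.

Definition sparse_vectors : set V :=
  [set a : V | `|a| <= 1 /\ (#|[set i | (a 0 i != 0)%R]%SET| <= d)%N].

Definition bad_point (a : V) : pred grid_point :=
  [pred x : grid_point | 1 < \sum_(i | a 0 i != 0) D (grid_coord (x i))].

(** Chernoff bound: by independence the exponential moment of the sum is at most
    (1 + lam / (2 d))^d <= exp(lam / 2), and bad points cost a factor
    exp(- lam). *)
Lemma sum_bad_le (a : V) : (#|[set i | (a 0 i != 0)%R]%SET| <= d)%N ->
  \sum_(x | bad_point a x) density x <= expR (- (lam / 2)).
Proof.
move=> ad.
apply: (@le_trans _ _ (\sum_(x : grid_point) expR (- lam) *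
    \prod_i (wt (grid_coord (x i)) / mass * expR (if a 0 i != 0 then lam * D (grid_coord (x i)) else 0)))).
  rewrite big_mkcond; apply: ler_sum => x _.
  rewrite big_split /= -/(density x) -expR_sum mulrCA -expRD.
  rewrite -big_mkcond /= -mulr_sumr.
  case: ifP => [bx|_]; last by rewrite mulr_ge0 ?density_ge0 ?expR_ge0.
  rewrite ler_peMr ?density_ge0 // -expR0 ler_expR.
  move: bx; rewrite /bad_point /= => bx; rewrite addrC subr_ge0 ler_peMr //; exact: ltW.
rewrite -mulr_sumr (sum_prod (fun i k => wt (grid_coord k) / mass *
   expR (if a 0 i != 0 then lam * D (grid_coord k) else 0))).
have -> : - (lam / 2) = - lam + lam / 2 by field.
rewrite expRD ler_pM2l ?expR_gt0 //.
have l0 : 0 <= lam / (2 * d%:R) by rewrite divr_ge0 // ltW.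
apply: (@le_trans _ _ (\prod_(i < n) expR (if a 0 i != 0 then lam / (2 * d%:R) else 0))).
  apply: ler_prod => i _; apply/andP; split.
    apply: sumr_ge0 => k _; rewrite mulr_ge0 ?expR_ge0 //.
    by rewrite divr_ge0 // ltW // mass_gt0.
  case: ifP => ai; last first.
    by under eq_bigr do rewrite expR0 mulr1; rewrite -mulr_suml divff ?expR0 // gt_eqF // mass_gt0.
  under eq_bigr do rewrite mulrAC.
  rewrite -mulr_suml ler_pdivrMr ?mass_gt0 //; apply: (le_trans D_mgf).
  by rewrite ler_pM2r ?mass_gt0 // expR_ge1Dx.
rewrite -expR_sum ler_expR -big_mkcond /= sumr_const.
rewrite (_ : lam / 2 = (lam / (2 * d%:R)) *+ d); last first.
  by rewrite -mulr_natr; field; rewrite pnatr_eq0 -lt0n.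
by apply: ler_wpMn2l => //; move: ad; rewrite cardsE.
Qed.

(** Rounding down keeps zero coordinates at zero, so the rounded step is as sparse
    as the original one. *)
Definition round_step (a : V) (i : 'I_n) : int := Num.floor (m%:R * a 0 i).

Lemma rV_coord_le (a : V) i : `|a 0 i| <= `|a|.
Proof.
have -> : `|a| = mx_norm a by [].
by rewrite mx_normrE; apply/bigmax_geP; right; exists (0, i).
Qed.

Lemma round_step0 (a : V) i : a 0 i = 0 -> round_step a i = 0.
Proof. by rewrite /round_step => ->; rewrite mulr0 floor0. Qed.

Lemma round_step_le (a : V) i : `|a| <= 1 -> `|(round_step a i)%:~R| <= m%:R :> R.
Proof.
move=> /(le_trans (rV_coord_le a i)); rewrite !ler_norml => /andP[a1 a2].
have := floor_le (m%:R * a 0 i); rewrite -/(round_step a i) => h1.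
have := mR; move=> m0; apply/andP; split; last nra.
rewrite -[m%:R]/((m : int)%:~R) -intrN ler_int /round_step floor_ge_int.
by rewrite intrN /=; nra.
Qed.

Lemma round_step_dist (a : V) i : `|a 0 i - (round_step a i)%:~R / m%:R| <= m%:R^-1.
Proof.
have := floor_itv (m%:R * a 0 i); rewrite -/(round_step a i) intrD => /andP[h1 h2].
have -> : a 0 i - (round_step a i)%:~R / m%:R = (m%:R * a 0 i - (round_step a i)%:~R) / m%:R.
  by field; rewrite gt_eqF.
rewrite normrM normfV (gtr0_norm mR) ler_piMl ?invr_ge0 ?ltW //.
by rewrite ger0_norm; lra.
Qed.

(** The truncations by [inord] and by the absolute value are never active at good
    points, see [coord_shift]. *)
Definition shift_point (x : grid_point) (z : 'I_n -> int) (c : int) : grid_point :=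
  [ffun i => inord `|((x i : int) + c * z i)%R|%N].

Lemma coord_shift (a : V) x c i : `|a| <= 1 -> ~~ bad_point a x -> `|c%:~R| <= 12 :> R ->
  grid_coord (shift_point x (round_step a) c i) =
  grid_coord (x i) + c%:~R * ((round_step a i)%:~R / m%:R).
Proof.
move=> a1 xgood c12; rewrite ffunE.
have [ai|ai] := eqVneq (a 0 i) 0.
  by rewrite round_step0 // mulr0 addr0 mul0r mulr0 addr0 absz_nat inord_val.
have z1 := round_step_le i a1; set z := round_step a i in z1 *.
have Di : D (grid_coord (x i)) <= 1.
  move: xgood; rewrite /bad_point /= -leNgt; apply: le_trans.
  by rewrite (bigD1 i) //= lerDl sumr_ge0.
have xi : `|grid_coord (x i)| <= M%:R / m%:R - 12.
  by rewrite leNgt; apply/negP => /D_edge; lra.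
have {xi} : `|(x i)%:R - M%:R| <= M%:R - 12 * m%:R :> R.
  move: xi; rewrite /grid_coord normrM normfV (gtr0_norm mR) ler_pdivrMr //.
  by rewrite mulrBl divfK ?gt_eqF.
rewrite ler_norml => /andP[x1 x2].
have cz : `|c%:~R * z%:~R| <= 12 * m%:R :> R by rewrite normrM; apply: ler_pM.
move: cz; rewrite ler_norml => /andP[cz1 cz2].
pose e : int := (x i : int) + c * z.
have eE : e%:~R = (x i)%:R + c%:~R * z%:~R :> R by rewrite /e intrD intrM.
have e0 : 0 <= e by rewrite -(ler_int R) eE; lra.
have e2 : e%:~R <= (2 * M)%:R :> R by rewrite eE natrM; lra.
rewrite -/e /grid_coord inordK; last first.
  by rewrite ltnS -(ler_nat R) natr_absz ger0_norm.
rewrite natr_absz ger0_norm // eE; field; exact: lt0r_neq0.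
Qed.

Lemma expR_N1_ge : 4^-1 <= expR (- 1) :> R.
Proof.
have h := expR_ge1Dx (- 2^-1 : R).
have -> : - 1 = - 2^-1 + - 2^-1 :> R by field.
by rewrite expRD; nra.
Qed.

(** The product of the two shifted densities is at least exp(- 1) times the square
    of the density, and exp(- 1) >= 1/4; so one of the two shifted points has at
    least half the density of x. *)
Lemma density_shift (a : V) x c : `|a| <= 1 -> ~~ bad_point a x -> `|c%:~R| <= 12 :> R ->
  density x ^+ 2 <= 4 * (density (shift_point x (round_step a) c) *
                         density (shift_point x (round_step a) (- c))).
Proof.
move=> a1 xgood c12.
have c12' : `|(- c)%:~R| <= 12 :> R by rewrite intrN normrN.
have T0 := mass_gt0.
have h : expR (- \sum_(i | a 0 i != 0) D (grid_coord (x i))) * density x ^+ 2 <=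
   density (shift_point x (round_step a) c) * density (shift_point x (round_step a) (- c)).
  rewrite big_mkcond /= -sumrN expR_sum /density expr2 -!big_split /=.
  apply: ler_prod => i _; apply/andP; split.
    have w0 y : 0 <= wt y / mass by rewrite divr_ge0 // ltW.
    by rewrite mulr_ge0 ?expR_ge0 // mulr_ge0.
  rewrite (coord_shift i a1 xgood c12) (coord_shift i a1 xgood c12') intrN mulNr.
  rewrite !mulf_div -expr2 [leLHS]mulrA ler_pM2r ?invr_gt0 ?mulr_gt0 //.
  case: ifPn => [_|/negPn/eqP ai].
    apply: D_shift; rewrite mulrA normrM normrM normfV (gtr0_norm mR).
    rewrite ler_pdivrMr //; apply: ler_pM => //; exact: round_step_le.
  by rewrite oppr0 expR0 mul1r round_step0 // mul0r mulr0 addr0 subr0 expr2.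
have e1 : 4^-1 <= expR (- \sum_(i | a 0 i != 0) D (grid_coord (x i))).
  apply: (le_trans expR_N1_ge); rewrite ler_expR lerN2.
  by move: xgood; rewrite /bad_point /= -leNgt.
have := ler_wpM2r (sqr_ge0 (density x)) e1; lra.
Qed.

Lemma density_gt0 x : 0 < density x.
Proof. by apply: prodr_gt0 => i _; rewrite divr_gt0 // mass_gt0. Qed.

(** The constant 1/m added to [window_inf] pays for rounding the step, as u is
    1-Lipschitz. *)
Lemma expect_step (a : V) u : sparse_vectors a -> cvx_lip u ->
  exists v, [/\ cvx_lip v, forall x, Num.min (u (x + a)) (u (x - a)) <= v x &
    expect v <= expect u + (expR (- (lam / 2)) + m%:R^-1)].
Proof.
move=> [a1 ad] cu; pose z := round_step a.
pose ra : V := \row_i ((z i)%:~R / m%:R).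
have ra1 : `|ra| <= 1.
  apply: rV_norm_le => // i; rewrite mxE normrM normfV (gtr0_norm mR).
  by rewrite ler_pdivrMr // mul1r; exact: round_step_le.
have ara : `|a - ra| <= m%:R^-1.
  apply: rV_norm_le => [|i]; first by rewrite invr_ge0 ltW.
  by rewrite !mxE; exact: round_step_dist.
exists (fun x => window_inf u ra x + m%:R^-1); split.
- exact/cvx_lipDc/cvx_lip_window_inf.
- move=> x.
  have h1 : u (x + a) <= u (x + ra) + m%:R^-1.
    rewrite -lerBlDl; apply: le_trans (cu.2 _ _) _.
    by rewrite opprD addrACA subrr add0r.
  have h2 : u (x - a) <= u (x - ra) + m%:R^-1.
    rewrite -lerBlDl; apply: le_trans (cu.2 _ _) _.
    by rewrite opprB addrC addrA subrK distrC.
  have := window_inf_ge ra x cu; rewrite !ge_min => /orP[h|h].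
    by apply/orP; left; lra.
  by apply/orP; right; lra.
- have -> : expect (fun x => window_inf u ra x + m%:R^-1) =
      expect (window_inf u ra) + m%:R^-1.
    rewrite /expect; under eq_bigr do rewrite mulrDr; rewrite big_split /=.
    by rewrite -mulr_suml sum_density mul1r.
  rewrite addrA lerD2r.
  apply: (le_trans (@sum_window_inf_le _ _ _ density grid_pos u ra (bad_point a)
    density_ge0 grid_pos_inj cu ra1 _)); last by rewrite lerD2l; exact: sum_bad_le.
  move=> x xgood k.
  (* 'I_4 indexes the distances 3, 6, 9, 12 *)
  pose c : int := 3 * (k.+1 : int).
  have c12 : `|c%:~R| <= 12 :> R.
    rewrite /c intrM ger0_norm ?mulr_ge0 //.
    have : (k.+1%:R : R) <= 4 by rewrite ler_nat; exact: ltn_ord.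
    rewrite /=; lra.
  have c12' : `|(- c)%:~R| <= 12 :> R by rewrite intrN normrN.
  have pos_shift e : `|e%:~R| <= 12 :> R ->
      grid_pos (shift_point x z e) = grid_pos x + e%:~R *: ra.
    by move=> e12; apply/rowP => i; rewrite !mxE coord_shift.
  have := density_shift a1 xgood c12; rewrite -/z.
  have := density_gt0 x.
  have := density_ge0 (shift_point x z c).
  have := density_ge0 (shift_point x z (- c)).
  have [h _ _ _ _|h p1 p2 p3 p4] :=
      leP (density x) (2 * density (shift_point x z c)).
    by exists (shift_point x z c), (k.+1 : int); rewrite pos_shift // /c intrM.
  exists (shift_point x z (- c)), (- (k.+1 : int)); split.
  + by rewrite abszN.
  + by rewrite pos_shift // /c -mulrN intrM.
  + nra.
Qed.

End ProductGrid.

(** * The one-dimensional potential *)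

Section Potential.
Context {R : realType}.
Implicit Types (x y t b h : R).

(** The squared distance of x to [-b, b]. *)
Definition hinge b x : R := Num.max (`|x| - b) 0 ^+ 2.

Lemma hinge_ge0 b x : 0 <= hinge b x. Proof. exact: sqr_ge0. Qed.

Lemma hinge_le_sqr b x y : `|y| <= b -> hinge b x <= (x - y) ^+ 2.
Proof.
move=> yb; rewrite /hinge -[leRHS](real_normK (num_real _)) ler_sqr ?nnegrE ?le_max ?lexx ?orbT //.
rewrite ge_max normr_ge0 andbT; have := lerB_dist x y; lra.
Qed.

(** Comparing with the nearest point y of [-b, b] reduces the second difference to
    that of (x - y)^2, which is 2 t^2; near the centre it vanishes. *)
Lemma hinge_shift b x t h : 0 <= b -> `|t| <= h ->
  hinge b (x + t) + hinge b (x - t) <=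
  2 * hinge b x + (if b < `|x| + h then 2 * h ^+ 2 else 0).
Proof.
move=> b0 th.
have small z : `|z| <= b -> hinge b z = 0.
  by move=> zb; rewrite /hinge max_r ?expr0n // subr_le0.
case: ltP => [_|xb]; last first.
  rewrite !small; first lra.
  - by have := normr_ge0 t; lra.
  - by apply: le_trans (ler_normB _ _) _; lra.
  - by apply: le_trans (ler_normD _ _) _; lra.
have t2 : t ^+ 2 <= h ^+ 2.
  by rewrite -[t ^+ 2](real_normK (num_real _)) ler_sqr ?nnegrE // (le_trans _ th).
suff [y yb ->] : exists2 y, `|y| <= b & hinge b x = (x - y) ^+ 2.
  have := hinge_le_sqr (x + t) yb; have := hinge_le_sqr (x - t) yb; nra.
have [xb|xb] := leP `|x| b; first by exists x; rewrite // small // subrr expr0n.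
have [x0|x0] := leP 0 x.
  exists b; first by rewrite ger0_norm.
  by rewrite /hinge ger0_norm // max_l // subr_ge0 -(ger0_norm x0) ltW.
exists (- b); first by rewrite normrN ger0_norm.
rewrite /hinge ltr0_norm // max_l; last by rewrite subr_ge0 -(ltr0_norm x0) ltW.
ring.
Qed.

Lemma expR_sub1_le x : expR x - 1 <= x * expR x.
Proof.
have := expR_ge1Dx (- x); have := expR_gt0 x; rewrite expRN => h1 h2.
have : (1 - x) * expR x <= 1 by rewrite -ler_pdivlMr // mul1r.
lra.
Qed.

Lemma expRN_le_inv x : 0 < x -> expR (- x) <= x^-1.
Proof.
move=> x0; rewrite expRN lef_pV2 ?posrE ?expR_gt0 //.
by have := expR_ge1Dx x; lra.
Qed.

Lemma expR_half_le2 : expR 2^-1 <= 2 :> R.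
Proof.
have := expR_ge1Dx (- 2^-1 : R); rewrite expRN => h1.
have : 2^-1 <= (expR 2^-1)^-1 :> R by lra.
by rewrite lef_pV2 ?posrE ?expR_gt0.
Qed.

Lemma sqr_le_expR x : 0 <= x -> x ^+ 2 <= 16 * expR (x / 2).
Proof.
move=> x0; have h := expR_ge1Dx (x / 4).
have -> : x / 2 = x / 4 + x / 4 by field.
have : 0 <= x / 4 by lra.
rewrite expRD; nra.
Qed.

(** The box has half-width 5 Rad with Rad = K s of order sqrt d, and h is the
    largest shift, 12, in the unit Rad.  There are J + 1 levels; [knot] runs from
    1 to at most 4, and consecutive knots are 2^-j + 1/J apart. *)
Variables (K d s J : nat).
Hypothesis K_large : 2 ^+ 14 <= K%:R :> R.
Hypothesis d_gt0 : (0 < d)%N.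
Hypothesis s_ge : (d <= s ^ 2)%N.
Hypothesis s_le : (s ^ 2 <= 4 * d)%N.
Hypothesis J_large : (K * d <= 2 ^ J)%N.
Hypothesis J_small : (24 * J <= K * s)%N.

Notation Rad := (K%:R * s%:R : R).
Notation h := (12 / Rad).
Definition knot j : R := 3 - 2 * 2^-1 ^+ j + j%:R / J%:R.
Definition potential x : R := \sum_(j < J.+1) 16 ^+ j * hinge (knot j) (x / Rad).
Definition weight x : R := expR (- potential x).
Definition curvature x : R :=
  \sum_(j < J.+1) 16 ^+ j * (if knot j < `|x / Rad| + h then 2 * h ^+ 2 else 0).
(** The jump by 2 near the ends of the box declares these points bad. *)
Definition cost x : R := curvature x + (if 5 * Rad - 12 < `|x| then 2 else 0).
Definition rate : R := d%:R / J%:R ^+ 2.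

Let J_gt0 : (0 < J)%N.
Proof.
have K2 : (1 < K)%N by rewrite -(ltr_nat R); have := K_large; lra.
rewrite lt0n; apply/eqP => J0; move: J_large; rewrite J0 expn0.
by rewrite leqNgt (leq_trans K2) // leq_pmulr.
Qed.
Let JR : 1 <= J%:R :> R. Proof. by rewrite ler1n. Qed.
Let s_gt0 : (0 < s)%N.
Proof. by rewrite lt0n; apply/eqP => s0; move: s_ge; rewrite s0 leqNgt d_gt0. Qed.
Let sR : 1 <= s%:R :> R. Proof. by rewrite ler1n. Qed.
Let dR : 1 <= d%:R :> R. Proof. by rewrite ler1n. Qed.
Let sdR : d%:R <= s%:R ^+ 2 :> R. Proof. by rewrite -natrX ler_nat. Qed.
Let sdR' : s%:R ^+ 2 <= 4 * d%:R :> R. Proof. by rewrite -natrX -natrM ler_nat. Qed.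
Let JdR : K%:R * d%:R <= 2 ^+ J :> R.
Proof. by rewrite -natrX -natrM ler_nat. Qed.
Let K1 : 1 <= K%:R :> R. Proof. by have := K_large; lra. Qed.
Let S_gt0 : 0 < Rad. Proof. by have := sR; have := K1; nra. Qed.

Lemma h_le : h <= J%:R^-1 / 2.
Proof.
rewrite ler_pdivrMr //; have J0 : 0 < J%:R :> R by have := JR; lra.
have : (24 * J)%:R <= (K * s)%:R :> R by rewrite ler_nat.
have q0 : 0 <= J%:R^-1 :> R by rewrite invr_ge0 ltW.
move=> /(ler_wpM2r q0); rewrite !natrM mulfK ?lt0r_neq0 //; lra.
Qed.

Lemma knotS j : knot j.+1 = knot j + (2^-1 ^+ j + J%:R^-1).
Proof.
rewrite /knot exprS -natr1; field.
by have := JR => JR0; apply: lt0r_neq0; lra.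
Qed.

Lemma knot_ge1 j : 1 <= knot j.
Proof.
rewrite /knot; have : 2^-1 ^+ j <= (1 : R) by rewrite exprn_ile1 //; lra.
have : 0 <= (j%:R / J%:R : R) by rewrite divr_ge0.
lra.
Qed.

Lemma knot_max : knot J <= 4.
Proof.
have := JR => JR0; rewrite /knot divff; last by apply: lt0r_neq0; lra.
have : 0 <= 2^-1 ^+ J :> R by rewrite exprn_ge0 //; lra.
lra.
Qed.

Lemma level_ge0 j x : 0 <= 16 ^+ j * hinge (knot j) (x / Rad).
Proof. by apply: mulr_ge0; [exact: exprn_ge0|exact: hinge_ge0]. Qed.

Lemma potential_ge0 x : 0 <= potential x.
Proof. by apply: sumr_ge0 => j _; exact: level_ge0. Qed.

Lemma weight_gt0 x : 0 < weight x. Proof. exact: expR_gt0. Qed.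

Lemma weightN x : weight (- x) = weight x.
Proof. by rewrite /weight /potential /hinge; under eq_bigr do rewrite mulNr normrN. Qed.

Lemma curvature_ge0 x : 0 <= curvature x.
Proof.
apply: sumr_ge0 => j _; rewrite mulr_ge0 ?exprn_ge0 //.
by case: ifP => // _; rewrite mulr_ge0 // sqr_ge0.
Qed.

Lemma cost_ge0 x : 0 <= cost x.
Proof. by rewrite addr_ge0 ?curvature_ge0 //; case: ifP. Qed.

Lemma cost_shift x t : `|t| <= 12 ->
  expR (- cost x) * weight x ^+ 2 <= weight (x + t) * weight (x - t).
Proof.
move=> t12; rewrite /weight expr2 -!expRD ler_expR.
suff : potential (x + t) + potential (x - t) <= 2 * potential x + curvature x.
  by rewrite /cost; case: ifP => _; lra.
rewrite /potential /curvature mulr_sumr -!big_split /=; apply: ler_sum => j _.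
have th : `|t / Rad| <= h.
  by rewrite normrM normfV (gtr0_norm S_gt0) ler_pM2r ?invr_gt0.
have k0 : 0 <= knot j by have := knot_ge1 j; lra.
rewrite (mulrDl x) (mulrBl _ x); have := hinge_shift (x / Rad) k0 th.
move=> /(ler_wpM2l (exprn_ge0 j (ler0n R 16))); move: (16 ^+ j) => c.
by rewrite -mulrDr [2 * (c * _)]mulrCA -mulrDr; apply.
Qed.

(** Where level j + 1 may start to curve, x lies at least half a gap beyond knot j,
    as h is at most half of 1/J.  This is how the potential pays for its own
    curvature. *)
Lemma hinge_below x j : knot j.+1 < `|x / Rad| + h ->
  (2^-1 ^+ j + J%:R^-1) ^+ 2 / 4 <= hinge (knot j) (x / Rad).
Proof.
rewrite knotS => kx; have hh := h_le.
have w0 : 0 <= 2^-1 ^+ j :> R by rewrite exprn_ge0 //; lra.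
have J0 : 0 < J%:R^-1 :> R by rewrite invr_gt0; have := JR; lra.
have wJ : J%:R^-1 <= 2^-1 ^+ j + J%:R^-1 :> R by rewrite lerDr.
have w1 := addr_ge0 w0 (ltW J0); move: (2^-1 ^+ j + J%:R^-1) kx wJ w1 => w kx wJ w1.
have g : w / 2 <= `|x / Rad| - knot j by lra.
rewrite /hinge max_l; last by lra.
have -> : w ^+ 2 / 4 = (w / 2) ^+ 2 by field.
by rewrite ler_sqr ?nnegrE; lra.
Qed.

Lemma h_sqr : h ^+ 2 = 144 / Rad ^+ 2.
Proof. by rewrite expr_div_n -natrX. Qed.

Lemma d_h_sqr : d%:R * h ^+ 2 <= 144 / 2 ^+ 28.
Proof.
have := sdR => sd; have := sR => s1; have := K_large => K14.
rewrite h_sqr mulrCA; apply: ler_wpM2l => //.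
rewrite ler_pdivrMr ?exprn_gt0 // exprMn ler_pdivlMl ?exprn_gt0 //.
have : (2 ^+ 14) ^+ 2 <= K%:R ^+ 2 :> R by rewrite ler_sqr ?nnegrE // exprn_ge0.
rewrite -exprM => K28; apply: ler_pM => //; exact: exprn_ge0.
Qed.

Lemma rate_h_sqr : rate * h ^+ 2 <= J%:R^-1 ^+ 2 / 2 ^+ 9.
Proof.
have := d_h_sqr => dh; rewrite /rate exprVn mulrAC [leRHS]mulrC.
apply: ler_wpM2r; first by rewrite invr_ge0 exprn_ge0.
apply: (le_trans dh); lra.
Qed.

Lemma rate_ge0 : 0 <= rate. Proof. by rewrite divr_ge0 ?exprn_ge0. Qed.

(** Level by level: the factor 16 between consecutive weights is absorbed since
    rate h^2 is small compared with the square 1/J^2 of the smallest gap. *)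
Lemma rate_curvature_le x :
  rate * curvature x <= 2 * (rate * h ^+ 2) + potential x / 4.
Proof.
have r0 := rate_ge0; have rh := rate_h_sqr; set q := rate * h ^+ 2 in rh *.
have q0 : 0 <= q by rewrite mulr_ge0 // sqr_ge0.
rewrite /curvature big_ord_recl mulrDr expr0 mul1r; apply: lerD.
  case: ifP => _; last by rewrite mulr0 mulr_ge0.
  by rewrite mulrCA.
rewrite /potential big_ord_recr /= [leRHS]mulrDl; apply: ler_wpDr.
  by apply: divr_ge0 => //; exact: level_ge0.
rewrite mulr_sumr mulr_suml; apply: ler_sum => j _.
rewrite /bump leq0n add1n; case: ltP => [/hinge_below hb|_]; last first.
  by rewrite !mulr0; apply: divr_ge0 => //; exact: level_ge0.
have -> : rate * (16 ^+ j.+1 * (2 * h ^+ 2)) = 16 ^+ j * (32 * q).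
  by rewrite /q exprS; ring.
rewrite -mulrA; apply: ler_wpM2l; first exact: exprn_ge0.
have w0 : 0 <= 2^-1 ^+ j :> R by rewrite exprn_ge0 //; lra.
have J0 : 0 < J%:R^-1 :> R by rewrite invr_gt0; have := JR; lra.
have : J%:R^-1 ^+ 2 <= (2^-1 ^+ j + J%:R^-1) ^+ 2 :> R by rewrite ler_sqr ?nnegrE; lra.
lra.
Qed.

(** Level j, once entered by half of its gap, contributes at least 4^j / 4 to the
    potential, so its weight 16^j is bounded by a multiple of the square of that
    contribution. *)
Lemma curvature_le_potential x :
  curvature x <= h ^+ 2 * (2 + 2 ^+ 9 * potential x ^+ 2).
Proof.
have h20 : 0 <= h ^+ 2 by rewrite sqr_ge0.
pose p j := 16 ^+ j * hinge (knot j) (x / Rad).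
have p0 j : 0 <= p j by exact: level_ge0.
have sumsq k : \sum_(j < k) p j ^+ 2 <= (\sum_(j < k) p j) ^+ 2.
  elim: k => [|k IH]; first by rewrite !big_ord0 expr0n.
  rewrite !big_ord_recr /=; have := p0 k.
  have : 0 <= \sum_(j < k) p j by apply: sumr_ge0.
  nra.
apply: (@le_trans _ _ (h ^+ 2 * (2 + 2 ^+ 9 * \sum_(j < J) p j ^+ 2))); last first.
  rewrite ler_wpM2l // lerD2l; apply: ler_wpM2l; first exact: exprn_ge0.
  apply: (le_trans (sumsq J)).
  rewrite ler_sqr ?nnegrE ?potential_ge0 ?sumr_ge0 //.
  by rewrite /potential big_ord_recr /= lerDl; exact: p0.
rewrite /curvature big_ord_recl mulrDr expr0 mul1r; apply: lerD.
  by case: ifP => _; lra.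
rewrite !mulr_sumr; apply: ler_sum => j _.
rewrite lift0; case: ltP => [/hinge_below hb|_]; last first.
  by rewrite mulr0; apply: mulr_ge0 => //; apply: mulr_ge0; [exact: exprn_ge0|exact: sqr_ge0].
have -> : 16 ^+ j.+1 * (2 * h ^+ 2) = h ^+ 2 * (32 * 16 ^+ j) by rewrite exprS; ring.
apply: ler_wpM2l => //.
have w0 : 0 < 2^-1 ^+ j :> R by rewrite exprn_gt0 //; lra.
have J0 : 0 < J%:R^-1 :> R by rewrite invr_gt0; have := JR; lra.
have e4 : 4 ^+ j / 4 <= p j.
  have : 2^-1 ^+ j ^+ 2 / 4 <= hinge (knot j) (x / Rad) by apply: le_trans hb; nra.
  move=> /(ler_wpM2l (exprn_ge0 j (ler0n R 16))); rewrite -/(p j); apply: le_trans.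
  rewrite mulrA ler_pM2r ?invr_gt0 // -exprM mulnC exprM -exprMn.
  have -> : 16 * 2^-1 ^+ 2 = 4 :> R by field.
  exact: lexx.
have e40 : 0 <= 4 ^+ j / 4 :> R by rewrite divr_ge0 // exprn_ge0.
have : (4 ^+ j / 4) ^+ 2 <= p j ^+ 2 by rewrite ler_sqr ?nnegrE //; exact: p0.
have -> : (4 ^+ j / 4) ^+ 2 = 16 ^+ j / 16 :> R.
  rewrite expr_div_n -exprM mulnC exprM.
  have -> : 4 ^+ 2 = 16 :> R by ring.
  by [].
lra.
Qed.

Lemma excess_interior x : weight x * (expR (rate * curvature x) - 1) <=
  2 ^+ 15 * (rate * h ^+ 2).
Proof.
have P0 := potential_ge0 x; have r0 := rate_ge0.
have c0 := curvature_ge0 x; have h20 : 0 <= h ^+ 2 by rewrite sqr_ge0.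
have J0 : 0 < J%:R^-1 :> R by rewrite invr_gt0; have := JR; lra.
have J1 : J%:R^-1 <= 1 :> R by rewrite invf_le1 //; have := JR; lra.
have rh : 2 * (rate * h ^+ 2) <= 2^-1.
  have := rate_h_sqr; nra.
set P := potential x in P0 *.
have e1 : 1 <= expR (P / 2) by have := expR_ge1Dx (P / 2); lra.
have c1 : curvature x <= h ^+ 2 * (2 ^+ 14 * expR (P / 2)).
  apply: (le_trans (curvature_le_potential x)); apply: ler_wpM2l => //.
  have := sqr_le_expR P0; rewrite -/P; lra.
have e2 := expR_half_le2.
have e3 : expR (rate * curvature x) <= 2 * expR (P / 4).
  apply: (@le_trans _ _ (expR (2^-1 + P / 4))).
    by rewrite ler_expR; have := rate_curvature_le x; rewrite -/P; lra.
  by rewrite expRD ler_pM2r ?expR_gt0.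
apply: (@le_trans _ _ (weight x * ((rate * (h ^+ 2 * (2 ^+ 14 * expR (P / 2)))) * (2 * expR (P / 4))))).
  apply: ler_wpM2l; first exact: ltW (weight_gt0 x).
  apply: (le_trans (expR_sub1_le _)).
  by apply: ler_pM; [exact: mulr_ge0|exact: expR_ge0|exact: ler_wpM2l|exact: e3].
have -> : weight x * ((rate * (h ^+ 2 * (2 ^+ 14 * expR (P / 2)))) * (2 * expR (P / 4))) =
   2 ^+ 15 * (rate * h ^+ 2) * (weight x * expR (P / 2) * expR (P / 4)) by ring.
rewrite ler_piMr //; first by apply: mulr_ge0 => //; exact: mulr_ge0.
by rewrite /weight -/P -!expRD -[leRHS]expR0 ler_expR; lra.
Qed.

(** At the ends of the box the top level contributes at least 16^J / 4 to the
    potential; as 2^J >= K d, this dominates the exponent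
    rate * (curvature + 2) and makes the remainder smaller than rate * h^2. *)
Lemma excess_edge x : 5 * Rad - 12 < `|x| ->
  weight x * (expR (rate * (curvature x + 2)) - 1) <= 2 ^+ 15 * (rate * h ^+ 2).
Proof.
move=> xe; have r0 := rate_ge0; set P := potential x.
have := JR => JR0; have := dR => dR0; have := sR => sR0; have := sdR' => sd.
have P16 : 16 ^+ J / 4 <= P.
  have lev : 2^-1 <= `|x / Rad| - knot J.
    rewrite normrM normfV (gtr0_norm S_gt0).
    have : 5 - h <= `|x| / Rad.
      rewrite ler_pdivlMr // mulrBl divfK ?lt0r_neq0 //; lra.
    have := knot_max; have := h_le.
    have : J%:R^-1 <= 1 :> R by rewrite invf_le1 //; lra.
    lra.
  apply: (@le_trans _ _ (16 ^+ J * hinge (knot J) (x / Rad))).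
    apply: ler_wpM2l; first exact: exprn_ge0.
    rewrite /hinge max_l; last lra.
    by have := lev; nra.
  rewrite /P /potential big_ord_recr /= lerDr; apply: sumr_ge0 => j _.
  exact: level_ge0.
have JP : J%:R <= 2 ^+ J :> R.
  by rewrite -natrX ler_nat ltnW // ltn_expl.
have e16 : 16 ^+ J = (2 ^+ J) ^+ 4 :> R.
  rewrite -exprM mulnC exprM; congr (_ ^+ _); ring.
move: P16; rewrite e16; have := JdR; move: JP; set z := 2 ^+ J => JP zd P16.
have K14 := K_large.
have Kz : K%:R <= z by have := ler_peMr (ler0n R K) dR0; lra.
have z14 : 2 ^+ 14 <= z by lra.
have z4 : K%:R ^+ 2 * z ^+ 2 <= z ^+ 4.
  have -> : z ^+ 4 = z ^+ 2 * z ^+ 2 by ring.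
  by apply: ler_wpM2r; [exact: sqr_ge0|rewrite ler_sqr ?nnegrE; lra].
have zz : z <= z ^+ 4.
  have : z <= z ^+ 2 by nra.
  have -> : z ^+ 4 = z ^+ 2 * z ^+ 2 by ring.
  nra.
have rd : rate <= d%:R.
  have J2 : 1 <= J%:R ^+ 2 :> R by rewrite exprn_ege1.
  have J20 : 0 < J%:R ^+ 2 :> R by lra.
  by rewrite /rate ler_pdivrMr // ler_peMr.
have dz : 2 ^+ 14 * d%:R <= z ^+ 4 by have := ler_wpM2r (ler0n R d) K14; lra.
have JJ : J%:R ^+ 2 <= z ^+ 2 by rewrite ler_sqr ?nnegrE; lra.
have small : rate * (curvature x + 2) <= P / 2.
  rewrite mulrDr; have := rate_curvature_le x; rewrite -/P.
  have := rate_h_sqr.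
  have : J%:R^-1 <= 1 :> R by rewrite invf_le1 //; lra.
  have : 0 < J%:R^-1 :> R by rewrite invr_gt0; lra.
  move=> a1 a2; have : J%:R^-1 ^+ 2 <= 1 :> R by rewrite exprn_ile1 // ltW.
  move: (rate * h ^+ 2) (rate * curvature x) (J%:R^-1 ^+ 2) (z ^+ 4) P16 dz => a b c e.
  lra.
have P0 : 0 < P by lra.
apply: (@le_trans _ _ (expR (- (P / 2)))).
  apply: (@le_trans _ _ (weight x * expR (P / 2))).
    apply: ler_wpM2l; first exact: ltW (weight_gt0 x).
    have : expR (rate * (curvature x + 2)) <= expR (P / 2) by rewrite ler_expR.
    lra.
  by rewrite /weight -/P -expRD ler_expR; lra.
apply: (le_trans (expRN_le_inv _)); first lra.
have low : 36 / (K%:R ^+ 2 * J%:R ^+ 2) <= rate * h ^+ 2.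
  have -> : rate * h ^+ 2 = (36 / (K%:R ^+ 2 * J%:R ^+ 2)) * (4 * d%:R / s%:R ^+ 2).
    rewrite h_sqr /rate; field.
    by have := K1 => K1'; apply/and3P; split; apply: lt0r_neq0; lra.
  rewrite ler_peMr ?divr_ge0 ?mulr_ge0 ?exprn_ge0 //.
  by rewrite ler_pdivlMr ?mul1r // exprn_gt0; lra.
have low' : 36 / z ^+ 4 <= 36 / (K%:R ^+ 2 * J%:R ^+ 2).
  have K1' := K1; apply: ler_wpM2l => //.
  rewrite lef_pV2 ?posrE ?mulr_gt0 ?exprn_gt0 //; try lra.
  by apply: le_trans z4; apply: ler_wpM2l => //; exact: sqr_ge0.
have : (P / 2)^-1 <= 8 / z ^+ 4.
  rewrite -[leRHS]invf_div lef_pV2 ?posrE ?divr_gt0 ?exprn_gt0 //; lra.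
have : 0 <= (z ^+ 4)^-1 by rewrite invr_ge0 exprn_ge0 //; lra.
lra.
Qed.

Lemma weight_excess x : weight x * (expR (rate * cost x) - 1) <=
  2 ^+ 15 * (rate * h ^+ 2).
Proof.
rewrite /cost; case: ifP => [|_]; first exact: excess_edge.
by rewrite addr0; exact: excess_interior.
Qed.

Lemma weight_center x : `|x| <= Rad -> weight x = 1.
Proof.
move=> xS; rewrite /weight /potential big1 ?oppr0 ?expR0 // => j _.
rewrite /hinge max_r ?expr0n ?mulr0 // subr_le0 normrM normfV (gtr0_norm S_gt0).
by apply: le_trans (knot_ge1 j); rewrite ler_pdivrMr // mul1r.
Qed.

Variable m : nat.
Hypothesis m_gt0 : (0 < m)%N.
Notation M := (5 * (K * s * m))%N.

(** The potential vanishes on [-Rad, Rad], a fixed fraction of the box. *)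
Lemma mass_ge : (K * s * m)%:R <= mass M m weight.
Proof.
rewrite /mass; set N := (K * s * m)%N.
have mR : 0 < m%:R :> R by rewrite ltr0n.
pose g (k : nat) : R := weight ((k%:R - (5 * N)%:R) / m%:R).
rewrite -[leRHS]/(\sum_(k < (2 * (5 * N)).+1) g k) -(big_mkord xpredT g).
rewrite (big_cat_nat (n := (5 * N)%N)) //=; last by rewrite ltnW // ltnS leq_pmull.
rewrite ler_wpDl ?sumr_ge0 // => [k _|]; first exact: ltW (weight_gt0 _).
rewrite (big_cat_nat (n := (5 * N + N)%N)) //=; last first.
- by rewrite ltnW // ltnS mul2n -addnn leq_add2l leq_pmull.
- by rewrite leq_addr.
rewrite ler_wpDr ?sumr_ge0 // => [k _|]; first exact: ltW (weight_gt0 _).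
have -> : \sum_(5 * N <= k < 5 * N + N) g k = \sum_(5 * N <= k < 5 * N + N) 1.
  apply: eq_big_nat => k /andP[k1 k2]; rewrite /g weight_center //.
  rewrite normrM normfV (gtr0_norm mR) ler_pdivrMr // -natrB //.
  by rewrite ger0_norm // -!natrM ler_nat -/N leq_subLR ltnW.
by rewrite sumr_const_nat addKn.
Qed.

(** The pointwise bound [weight_excess] is summed over at most 11 times the total
    mass; K is large enough for the outcome to be at most rate / (2 d). *)
Lemma cost_mgf :
  \sum_(k < (2 * M).+1) weight (grid_coord m k) * expR (rate * cost (grid_coord m k)) <=
  (1 + rate / (2 * d%:R)) * mass M m weight.
Proof.
have -> : \sum_(k < (2 * M).+1) weight (grid_coord m k) * expR (rate * cost (grid_coord m k)) =
   mass M m weight + \sum_(k < (2 * M).+1) weight (grid_coord m k) * (expR (rate * cost (grid_coord m k)) - 1).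
  by rewrite /mass -big_split; apply: eq_bigr => k _ /=; ring.
rewrite mulrDl mul1r lerD2l.
apply: (@le_trans _ _ (\sum_(k < (2 * M).+1) 2 ^+ 15 * (rate * h ^+ 2))).
  by apply: ler_sum => k _; exact: weight_excess.
rewrite sumr_const card_ord -[leLHS]mulr_natr.
have := mass_ge; set T := mass _ _ _; set N := (K * s * m)%N => NT.
have K0 : (0 < K)%N by rewrite -(ltr_nat R); have := K1; lra.
have N1 : 1 <= N%:R :> R by rewrite ler1n /N !muln_gt0 K0 s_gt0 m_gt0.
have r0 := rate_ge0; have := dR => d1.
have q0 : 0 <= 2 ^+ 15 * (rate * h ^+ 2) by rewrite !mulr_ge0 // sqr_ge0.
apply: (@le_trans _ _ (2 ^+ 15 * (rate * h ^+ 2) * (11 * T))).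
  apply: ler_wpM2l => //; rewrite -natr1 mulnA natrM; lra.
rewrite mulrA; apply: ler_wpM2r; first lra.
have -> : 2 ^+ 15 * (rate * h ^+ 2) * 11 = rate * ((11 * 2 ^+ 15) * h ^+ 2) by ring.
apply: ler_wpM2l => //; rewrite -[leRHS]mul1r ler_pdivlMr; last lra.
have := d_h_sqr; lra.
Qed.

End Potential.

(** * Failure probability of the walk *)

Lemma ln2_ge_half {R : realType} : 2^-1 <= ln 2 :> R.
Proof. by rewrite -ler_expR lnK ?posrE // expR_half_le2. Qed.

Lemma ln_eM {R : realType} (x : R) : 0 < x -> ln (expR 1 * x) = 1 + ln x.
Proof. by move=> x0; rewrite lnM ?posrE ?expR_gt0 // expRK. Qed.

Lemma exists_sqr_approx d : (0 < d)%N -> exists s, (d <= s ^ 2 <= 4 * d)%N.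
Proof.
move=> d0; have ex : exists s, (d <= s ^ 2)%N by exists d; rewrite expnS expn1 leq_pmulr.
exists (ex_minn ex); case: ex_minnP => -[|[|s]] ds smin; first by move: ds; lia.
  by rewrite ds; lia.
rewrite ds /=; have := smin s.+1; have [_ /(_ isT)|h _] := leqP d (s.+1 ^ 2); first by lia.
by move: h; rewrite -!mulnn; nia.
Qed.

(** The lower bound on K makes the box wide enough for the potential, the upper
    bound lets 15 + log2 d levels suffice, and their number is at most
    15 ln(e d).  The mesh 1/m is taken below exp(- rate / 2), so that rounding
    costs no more than the bad points. *)
Lemma online_balancing_scaled {R : realType} (K d n : nat) :
  2 ^+ 14 <= K%:R :> R -> (K <= 2 ^ 14)%N -> (0 < d)%N ->
  exists A : online_algorithm R n, forall (T : nat) (a : T.-tuple 'rV[R]_n),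
    sparse_unit_vectors d a ->
    let far := [set w | (11 * K%:R * Num.sqrt d%:R < max_prefix_norm a (online_signs a w))%R] in
    measurable far /\
    (alg_prob A far <=
      (2 * T%:R ^+ 2 * expR (- (d%:R / (2 * (15 * ln (expR 1 * d%:R)) ^+ 2))))%:E)%E.
Proof.
move=> K14 Kle d0; have [s /andP[s1 s2]] := exists_sqr_approx d0.
have dR : 1 <= d%:R :> R by rewrite ler1n.
have s0 : (0 < s)%N by case: s s1 {s2} => //; rewrite exp0n // leqn0 => /eqP e; rewrite e in d0.
pose t := trunc_log 2 d; pose J := (15 + t)%N.
have td : (2 ^ t <= d)%N by apply: trunc_logP.
have dt : (d < 2 ^ t.+1)%N by apply: trunc_log_ltn.
have ts : (t < 2 * s)%N.
  rewrite -(ltn_exp2l _ _ (isT : (1 < 2)%N)); apply: (leq_ltn_trans td).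
  by apply: (leq_ltn_trans s1); rewrite mulnC expnM ltn_exp2r // ltn_expl.
have J1 : (K * d <= 2 ^ J)%N.
  rewrite /J -[15%N]/(14 + 1)%N -addnA expnD add1n; apply: leq_mul => //; exact: ltnW.
have J2 : (24 * J <= K * s)%N.
  have K408 : (408 <= K)%N by rewrite -(ler_nat R); lra.
  by apply: (@leq_trans (408 * s)); [rewrite /J; lia|rewrite leq_mul2r K408 orbT].
pose lam : R := rate d J.
have J0R : 0 < J%:R :> R by rewrite ltr0n.
have lam0 : 0 < lam by rewrite /lam /rate divr_gt0 ?exprn_gt0 //; lra.
have [m mP] : exists m : nat, expR (lam / 2) < m%:R.
  by exists (Num.bound (expR (lam / 2))); apply: archi_boundP; exact: expR_ge0.
have m0 : (0 < m)%N by rewrite -(ltr_nat R); apply: lt_trans mP; exact: expR_gt0.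
have mR : 0 < m%:R :> R by rewrite ltr0n.
pose M := (5 * (K * s * m))%N.
have MmE : M%:R / m%:R = 5 * (K%:R * s%:R) :> R.
  by rewrite /M !natrM; field; exact: lt0r_neq0.
pose wt : R -> R := weight K s J; pose D := @cost R K s J.
pose b := @expect R n M m wt.
pose beta : R := expR (- (lam / 2)) + m%:R^-1.
have wt0 : forall x, 0 < wt x by exact: weight_gt0.
have D0 : forall x, 0 <= D x by move=> x; exact: cost_ge0.
have Dsh : forall x t, `|t| <= 12 -> expR (- D x) * wt x ^+ 2 <= wt (x + t) * wt (x - t).
  by move=> x t' ht; exact: (cost_shift J K14 d0 s1).
have Dedge : forall k : 'I_(2 * M).+1, M%:R / m%:R - 12 < `|grid_coord m k : R| -> 1 < D (grid_coord m k).
  move=> k; rewrite MmE /D /cost => ->; have := curvature_ge0 K s J (grid_coord m k : R); lra.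
have Dmgf := @cost_mgf R K d s J K14 d0 s1 s2 J1 J2 m m0.
exists (walk_algorithm b beta) => T a asp far.
have Ksd : 5 * (K%:R * s%:R) + 1 <= 11 * K%:R * Num.sqrt d%:R :> R.
  have sq : s%:R <= 2 * Num.sqrt d%:R :> R.
    rewrite -ler_sqr ?nnegrE ?mulr_ge0 ?sqrtr_ge0 // exprMn sqr_sqrtr ?ler0n //.
    by rewrite -!natrX -natrM ler_nat.
  have sq1 : 1 <= Num.sqrt d%:R :> R by rewrite -[leLHS]sqrtr1 ler_wsqrtr.
  nra.
pose r : R := 11 * K%:R * Num.sqrt d%:R - 1.
have r0 : 0 <= r by rewrite /r; have := mulr_ge0 (ler0n R K) (ler0n R s); lra.
have Mr : M%:R / m%:R <= r by rewrite MmE /r; lra.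
have be0 : 0 <= beta by rewrite addr_ge0 ?expR_ge0 // invr_ge0 ltW.
have aW t' : sparse_vectors d (tnth a t').
  have [at1 at2] := asp t'; split=> //; apply: rV_norm_le => // i.
  by rewrite ler_norml.
have := @walk_algorithm_far R n b (sparse_vectors d) beta (@expect_sum R n M m wt)
  (expect_ge0 M m0 wt0 (weightN K s J))
  (fun x u => @expect_step R n M m wt D d lam m0 wt0 D0 Dsh Dedge Dmgf lam0 d0 x u)
  T a r aW r0 be0 (expect_norm_excess wt m0 Mr).
rewrite /r subrK => -[mfar Pfar]; split=> //; apply: (le_trans Pfar).
rewrite lee_fin.
have beta_le : beta <= 2 * expR (- (lam / 2)).
  rewrite /beta; suff : m%:R^-1 <= expR (- (lam / 2)) by lra.
  by rewrite expRN lef_pV2 ?posrE ?expR_gt0 // ltW.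
set L := ln (expR 1 * d%:R); have LE : L = 1 + ln d%:R by rewrite /L ln_eM //; lra.
have lnd0 : 0 <= ln d%:R :> R by rewrite ln_ge0.
have tl : t%:R <= 2 * ln d%:R :> R.
  have : ln (2 ^+ t) <= ln d%:R :> R.
    by rewrite ler_ln ?posrE ?exprn_gt0 ?ltr0n // -natrX ler_nat.
  rewrite lnXn // -[_ *+ t]mulr_natr => h1; have := ler_wpM2r (ler0n R t) (@ln2_ge_half R); lra.
have JL : J%:R <= 15 * L by rewrite /J natrD LE; lra.
have lamL : d%:R / (2 * (15 * L) ^+ 2) <= lam / 2.
  have JJ : J%:R ^+ 2 <= (15 * L) ^+ 2 by rewrite ler_sqr ?nnegrE //; lra.
  have J20 : 0 < J%:R ^+ 2 :> R by exact: exprn_gt0.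
  have X0 := lt_le_trans J20 JJ.
  rewrite invfM (mulrC 2^-1) mulrA /lam /rate; apply: ler_wpM2r; first lra.
  by apply: ler_wpM2l => //; rewrite lef_pV2 ?posrE.
have : expR (- (lam / 2)) <= expR (- (d%:R / (2 * (15 * L) ^+ 2))) by rewrite ler_expR lerN2.
move=> h1; have T2 : 0 <= T%:R ^+ 2 :> R by exact: sqr_ge0.
have := ler_wpM2l T2 (le_trans beta_le (ler_wpM2l (ler0n R 2) h1)); lra.
Qed.

(** Halving the exponent turns the factor T^2 of the union bound into T: with
    x = exp(- q / 2), either T x <= 1, and then
    T^2 x^2 <= T x, or the bound exceeds 1. *)
Lemma online_balancing {R : realType} : exists2 C : R, 2 <= C &
  forall d n : nat, (0 < d)%N ->
  exists A : online_algorithm R n, forall (T : nat) (a : T.-tuple 'rV[R]_n),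
    sparse_unit_vectors d a ->
    (alg_prob A [set w | (C * Num.sqrt d%:R < max_prefix_norm a (online_signs a w))%R] <=
      (2 * T%:R * expR (- (d%:R / (30 * ln (expR 1 * d%:R)) ^+ 2)))%:E)%E.
Proof.
have [K [K14 Kle]] : exists K : nat, 2 ^+ 14 <= K%:R :> R /\ (K <= 2 ^ 14)%N.
  by exists (2 ^ 14)%N; rewrite natrX; split.
exists (11 * K%:R); first lra.
move=> d n d0; have [A hA] := @online_balancing_scaled R K d n K14 Kle d0.
exists A => T a asp; have [mfar] := hA T a asp.
set far := [set w | _]; set q := d%:R / (2 * _).
have -> : d%:R / (30 * ln (expR 1 * d%:R)) ^+ 2 = q / 2 :> R.
  by rewrite /q -mulrA -invfM; congr (_ / _); move: (ln _) => L; ring.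
have -> : expR (- q) = expR (- (q / 2)) ^+ 2.
  by rewrite -expRM_natl; congr expR; field.
have := expR_gt0 (- (q / 2)); move: (expR _) => x x0 Pfar.
have [Tx|Tx] := leP (T%:R * x) 1.
  apply: (le_trans Pfar); rewrite lee_fin.
  have : 0 <= T%:R * x by rewrite mulr_ge0 // ltW.
  nra.
apply: (@le_trans _ _ 1%E); first exact: probability_le1.
by rewrite lee_fin; lra.
Qed.

(** * From failure probability to prefix discrepancy *)

Lemma prefix_discrepancy_le {R : realType} (n T : nat) (a : T.-tuple 'rV[R]_n) e :
  prefix_discrepancy a <= max_prefix_norm a e.
Proof. by rewrite /prefix_discrepancy; case: arg_minP => // e' _; apply. Qed.

(** Otherwise every seed would fail. *)
Lemma prefix_discrepancy_of_prob {R : realType} (n T : nat) (a : T.-tuple 'rV[R]_n)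
    (A : online_algorithm R n) (r : R) :
  (alg_prob A [set w | (r < max_prefix_norm a (online_signs a w))%R] < 1)%E ->
  prefix_discrepancy a <= r.
Proof.
move=> P1; rewrite leNgt; apply/negP => rdisc.
suff E : [set w | (r < max_prefix_norm a (online_signs a w))%R] = [set: alg_space A].
  by move: P1; rewrite E probability_setT ltxx.
apply/seteqP; split=> // w _ /=; apply: (lt_le_trans rdisc).
exact: prefix_discrepancy_le.
Qed.

Lemma cube_le_expR {R : realType} (x : R) : 0 <= x -> (x / 3) ^+ 3 <= expR x.
Proof.
move=> x0; have -> : expR x = expR (x / 3) ^+ 3.
  by rewrite -expRM_natl; congr expR; field.
have h := expR_ge1Dx (x / 3); rewrite ler_pXn2r ?nnegrE ?expR_ge0 //; lra.
Qed.

(** Here L stands for ln (e d) and m for ln ln T.  If L <= 3 m the square of L can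
    be replaced by that of m; otherwise ln T = exp m is at most exp(L / 3), and
    exp(2 L / 3) beats L^2. *)
Lemma log_growth {R : realType} (L m : R) : 10 ^+ 7 <= m -> 1 <= L ->
  10 ^+ 5 * expR m * m ^+ 2 <= expR (L - 1) ->
  10 ^+ 4 * expR m * L ^+ 2 <= expR (L - 1).
Proof.
move=> m7 L1; have em := expR_gt0 m; have [L3 h|L3 _] := leP L (3 * m).
  apply: le_trans h; rewrite !(mulrAC _ (expR m)); apply: ler_wpM2r; first exact: ltW.
  have : L ^+ 2 <= (3 * m) ^+ 2 by rewrite ler_sqr ?nnegrE; lra.
  have m2 : 0 <= m ^+ 2 by exact: sqr_ge0.
  rewrite exprMn; lra.
have Lb : 3 * 10 ^+ 7 <= L by lra.
have e3 : expR m <= expR (L / 3) by rewrite ler_expR; lra.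
have e2 : 10 ^+ 4 * L ^+ 2 <= expR (L / 2).
  apply: le_trans (cube_le_expR _); last lra.
  have -> : (L / 2 / 3) ^+ 3 = L / 216 * L ^+ 2 by field.
  by apply: ler_wpM2r; [exact: sqr_ge0|lra].
apply: (@le_trans _ _ (expR (L / 3) * expR (L / 2))); last first.
  by rewrite -expRD ler_expR; lra.
rewrite mulrAC mulrC; apply: ler_pM; [exact: ltW| |exact: e3|exact: e2].
by apply: mulr_ge0; [exact: exprn_ge0|exact: sqr_ge0].
Qed.

Theorem theorem1p1 (R : realType) (eta : R) (eta_gt0 : 0 < eta) :
  (exists c C : R, [/\ 0 < c, 0 < C &
    forall d n : nat, (2 <= d)%N -> (d <= n)%N ->
    exists A : online_algorithm R n,
      forall (T : nat) (a : T.-tuple 'rV[R]_n),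
        (0 < T)%N -> sparse_unit_vectors d a ->
        (alg_prob A [set w | (C * Num.sqrt d%:R
                              < max_prefix_norm a (online_signs a w))%R]
         <= (C * T%:R *
             expR (- (c * d%:R / ln (expR 1 * d%:R) `^ (2 + eta))))%:E)%E])
  /\
  (exists C C' T0 : R, [/\ 0 < C, 0 < C', 0 < T0 &
    forall (d n T : nat) (a : T.-tuple 'rV[R]_n),
      (2 <= d)%N -> (d <= n)%N -> (0 < T)%N -> sparse_unit_vectors d a ->
      T0 <= T%:R ->
      C * ln T%:R * ln (ln T%:R) `^ (2 + eta) <= d%:R ->
      prefix_discrepancy a <= C' * Num.sqrt d%:R]).
Proof.
have [C C2 hC] := @online_balancing R.
have powR_ge_sqr (x : R) : 1 <= x -> x ^+ 2 <= x `^ (2 + eta).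
  move=> x1; rewrite -powR_mulrn; last lra.
  by apply: ler_powR => //; rewrite lerDl ltW.
split.
- exists (30 ^- 2), C; split; [by rewrite invr_gt0 exprn_gt0|lra|].
  move=> d n d2 _; have [A hA] := hC d n (ltnW d2).
  exists A => T a _ asp; apply: (le_trans (hA T a asp)); rewrite lee_fin.
  have d0 : 1 <= d%:R :> R by rewrite ler1n ltnW.
  apply: ler_pM; [exact: mulr_ge0|exact: expR_ge0|exact: ler_wpM2r|].
  rewrite ler_expR lerN2 ln_eM; last lra.
  have L1 : 1 <= 1 + ln d%:R :> R by rewrite lerDl ln_ge0.
  have L2 := powR_ge_sqr _ L1; move: (1 + ln d%:R) L1 L2 => L L1 L2.
  have L20 : 0 < L ^+ 2 by rewrite exprn_gt0 //; lra.
  rewrite exprMn [(_ * L ^+ 2)^-1]invfM (mulrC _ d%:R) [leRHS]mulrA; apply: ler_wpM2l.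
    by apply: mulr_ge0; [lra|rewrite invr_ge0 exprn_ge0].
  by rewrite lef_pV2 ?posrE // (lt_le_trans L20).
- exists (10 ^+ 5), C, (expR (expR (10 ^+ 7))); split.
  + exact: exprn_gt0.
  + lra.
  + exact: expR_gt0.
  move=> d n T a d2 dn T0 asp TT0 dT.
  have [A hA] := hC d n (ltnW d2).
  apply: (@prefix_discrepancy_of_prob R n T a A); apply: (le_lt_trans (hA T a asp)).
  rewrite lte_fin.
  have d0 : 1 <= d%:R :> R by rewrite ler1n ltnW.
  have TR : 0 < T%:R :> R by rewrite ltr0n.
  have l1 : expR (10 ^+ 7) <= ln T%:R :> R by rewrite -ler_expR lnK ?posrE.
  have l0 : 0 < ln T%:R :> R by apply: lt_le_trans l1; exact: expR_gt0.
  have m1 : 10 ^+ 7 <= ln (ln T%:R) :> R by rewrite -ler_expR lnK ?posrE.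
  have m11 : 1 <= ln (ln T%:R) :> R by apply: le_trans m1; rewrite exprn_ege1 //; lra.
  have := powR_ge_sqr _ m11.
  have lE : expR (ln (ln T%:R)) = ln T%:R :> R by rewrite lnK ?posrE.
  have TE : expR (ln T%:R) = T%:R :> R by rewrite lnK ?posrE.
  have dE : expR (ln d%:R) = d%:R :> R by rewrite lnK ?posrE //; lra.
  rewrite ln_eM; last lra.
  set m := ln (ln T%:R) in m1 m11 lE *; set l := ln T%:R in l1 l0 lE TE *.
  move=> m2; have l2 : 2 < l by apply: lt_le_trans l1; have := expR_ge1Dx (10 ^+ 7 : R); lra.
  have dm : 10 ^+ 5 * expR m * m ^+ 2 <= expR (1 + ln d%:R - 1).
    rewrite lE addrAC subrr add0r dE; apply: le_trans dT; apply: ler_wpM2l => //.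
    by apply: mulr_ge0; [exact: exprn_ge0|exact: ltW].
  have L1 : 1 <= 1 + ln d%:R :> R by rewrite lerDl ln_ge0.
  have := log_growth m1 L1 dm; rewrite lE.
  have -> : expR (1 + ln d%:R - 1) = d%:R :> R by rewrite addrAC subrr add0r dE.
  move: (1 + ln d%:R) L1 => L L1 dL {dm}.
  have L20 : 0 < L ^+ 2 by rewrite exprn_gt0 //; lra.
  have big : 2 * l <= d%:R / (30 * L) ^+ 2.
    rewrite ler_pdivlMr ?exprMn; last by rewrite mulr_gt0 // exprn_gt0.
    apply: le_trans dL; have := mulr_gt0 l0 L20; move: (L ^+ 2) => y ly.
    have -> : 2 * l * (30 ^+ 2 * y) = 1800 * (l * y) by ring.
    rewrite -mulrA; lra.
  apply: (@le_lt_trans _ _ (2 * expR (- l))).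
    rewrite -mulrA ler_pM2l // -TE -expRD ler_expR; lra.
  have := expRN_le_inv l0; have : l^-1 < 2^-1 by rewrite ltf_pV2 ?posrE.
  lra.
Qed.
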